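(* Let $n \ge 1$ be an integer, $p$ a prime, and $GF(p^n)$ the field with $p^n$ elements. Let $$a'(n) = \begin{cases} d(n)^2 + d(n) + \sigma(n)-2; & \text{if } p =2 \text{ and } n \text{ is even}, \\ d(n)^2 + d(n) + \sigma(n)-1; & \text{if } p =2 \text{ and } n \text{ is odd}, \\ d(n)^2 + d(n) + \sigma(n); & \text{if } p >2, \end{cases}$$ $$b'(n) = \frac{p^n-1}{p-1}+\sum_{d \mid n} \frac{p^n-1}{p^d-1}, \quad \text{and} \quad c(n) = d(2n)-d(n).$$ Then the compressed commuting graph of the ring $\mathcal{M}_2(GF(p^n))$ is $$\Lambda(\mathcal{M}_2(GF(p^n))) \cong K_{d(n)+1}^\circ \vee \left(\tfrac{p^{2n} + p^n}{2}K_{a'(n)}^\circ \cup (p^n + 1)K_{b'(n)}^\circ \cup \tfrac{p^{2n} - p^n}{2}K_{c(n)}^\circ\right).$$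
   Context: $\mathcal{M}_2(\mathbb{F})$ is the ring of $2\times 2$ matrices over the field $\mathbb{F}$. $d(n)$ is the number of positive divisors of $n$ and $\sigma(n)=\sum_{d\mid n} d$ is the sum of the positive divisors of $n$. $K_m^\circ$ is the complete graph on $m$ vertices with a loop at every vertex. For graphs $G,H$: $G\cup H$ is their disjoint union, $tG$ is the disjoint union of $t$ copies of $G$, and $G\vee H$ is their join (the disjoint union together with all edges between vertices of $G$ and vertices of $H$). For a ring $R$ and $a\in R$, $\langle a \rangle = \{q(a) \mid q \in \mathbb{Z}[x],\ q(0)=0\}$ is the (not necessarily unital) subring generated by $a$. The compressed commuting graph $\Lambda(R)$ is the undirected graph with vertex set $\{\langle a\rangle \mid a\in R\}$, in which $\langle a\rangle$ and $\langle b\rangle$ are joined by an edge (a loop if they are equal) iff $ab=ba$. *)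

(* Defs.v *)
From HB Require Import structures.
From mathcomp Require Import all_boot all_order all_algebra.
From mathcomp Require Import boolp classical_sets.

Set Implicit Arguments.
Unset Strict Implicit.
Unset Printing Implicit Defensive.

Import GRing.Theory.

Local Open Scope classical_set_scope.

(* Undirected graphs, possibly infinite; loops are allowed. *)
Record graph := Graph {
  vertex : Type;
  adj : vertex -> vertex -> Prop;
  adj_sym : forall x y, adj x y -> adj y x
}.

Definition graph_iso (G H : graph) : Prop :=
  exists f : vertex G -> vertex H,
    bijective f /\ forall x y, adj x y <-> adj (f x) (f y).

Definition looped_complete (m : nat) : graph :=
  @Graph 'I_m (fun _ _ => True) (fun _ _ _ => I).

Definition gunion_adj (G H : graph) (x y : vertex G + vertex H) : Prop :=
  match x, y with
  | inl u, inl v => adj u v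
  | inr u, inr v => adj u v
  | _, _ => False
  end.

Lemma gunion_adj_sym (G H : graph) (x y : vertex G + vertex H) :
  gunion_adj x y -> gunion_adj y x.
Proof. by case: x => x; case: y => y //=; apply: adj_sym. Qed.

Definition gunion (G H : graph) : graph := Graph (@gunion_adj_sym G H).

Definition gcopies_adj (t : nat) (G : graph) (x y : 'I_t * vertex G) : Prop :=
  x.1 = y.1 /\ adj x.2 y.2.

Lemma gcopies_adj_sym (t : nat) (G : graph) (x y : 'I_t * vertex G) :
  gcopies_adj x y -> gcopies_adj y x.
Proof. by case=> xy /adj_sym; split. Qed.

Definition gcopies (t : nat) (G : graph) : graph :=
  Graph (@gcopies_adj_sym t G).

Definition gjoin_adj (G H : graph) (x y : vertex G + vertex H) : Prop :=
  match x, y with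
  | inl u, inl v => adj u v
  | inr u, inr v => adj u v
  | _, _ => True
  end.

Lemma gjoin_adj_sym (G H : graph) (x y : vertex G + vertex H) :
  gjoin_adj x y -> gjoin_adj y x.
Proof. by case: x => x; case: y => y //=; apply: adj_sym. Qed.

Definition gjoin (G H : graph) : graph := Graph (@gjoin_adj_sym G H).

Section CompressedCommutingGraph.
Local Open Scope ring_scope.
Variable R : nzRingType.

(* The subring generated by a need not contain 1, whence q(0) = 0. *)
Definition gen_subring (a : R) : set R :=
  [set (map_poly intr q).[a] | q in [set q : {poly int} | q.[0] = 0]].

Definition ccg_vertex : Type := set_type (range gen_subring).

Definition ccg_adj (S T : ccg_vertex) : Prop :=
  exists a b : R,
    [/\ val S = gen_subring a, val T = gen_subring b & a * b = b * a].

Lemma ccg_adj_sym (S T : ccg_vertex) : ccg_adj S T -> ccg_adj T S.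
Proof. by move=> [a [b [Sa Tb ab]]]; exists b, a. Qed.

Definition compressed_commuting_graph : graph := Graph ccg_adj_sym.

Lemma gen_subring_id (a : R) : gen_subring a a.
Proof. by exists 'X; rewrite /= ?map_polyX hornerX. Qed.

Lemma horner_intr_comm (q : {poly int}) (a b : R) :
  a * b = b * a -> a * (map_poly intr q).[b] = (map_poly intr q).[b] * a.
Proof.
move=> ab; apply: commr_horner => // i.
by rewrite coef_map /=; apply/esym; apply: commr_int.
Qed.

(* Adjacency does not depend on the choice of the generators. *)
Lemma ccg_adjE (S T : ccg_vertex) (a b : R) :
  val S = gen_subring a -> val T = gen_subring b ->
  ccg_adj S T <-> a * b = b * a.
Proof.
move=> Sa Tb; split=> [[a' [b' [Sa' Tb' ab']]]|ab]; last by exists a, b.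
have [q _ <-] : gen_subring a' a by rewrite -Sa' Sa; apply: gen_subring_id.
have [r _ <-] : gen_subring b' b by rewrite -Tb' Tb; apply: gen_subring_id.
apply: horner_intr_comm; apply/esym; exact/horner_intr_comm/esym.
Qed.

End CompressedCommutingGraph.

Definition num_divisors (n : nat) : nat := size (divisors n).

Definition sum_divisors (n : nat) : nat := \sum_(d <- divisors n) d.

(* For p prime and n > 0, the subtractions below do not truncate and all the
   divisions are exact. *)
Definition a' (p n : nat) : nat :=
  let s := num_divisors n ^ 2 + num_divisors n + sum_divisors n in
  if p == 2 then (if odd n then s - 1 else s - 2) else s.

Definition b' (p n : nat) : nat :=
  (p ^ n - 1) %/ (p - 1) + \sum_(d <- divisors n) (p ^ n - 1) %/ (p ^ d - 1).

Definition c (n : nat) : nat := num_divisors (2 * n) - num_divisors n.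

(* Main.v *)
(** A non-scalar matrix [A] lies in exactly one of the maximal commutative
    subalgebras [F + F A], and two non-scalar matrices commute iff these
    subalgebras coincide; since [F + F A] only depends on the line spanned by
    [A] modulo the scalars, the blocks of the graph are indexed by the
    projective plane over [F].  The subalgebra is [F * F], the dual numbers or
    the quadratic extension of [F], according to the number of eigenvalues of
    [A], and it remains to count in each of them the subrings generated by one
    element outside [F].  The subfields are the fixed sets of the powers of
    Frobenius.  In [F * F], [(a, b)] generates the product of the subfields
    generated by [a] and [b], unless [b] is a nonzero conjugate of [a], in which
    case it generates the graph of an automorphism.  In the dual numbers,
    [a + m eps] generates [K + K m eps], where [K] is the subfield generated by
    [a] (and [F_p m eps] when [a = 0]). *)

From HB Require Import structures.
Require Import Defs.
From mathcomp Require Import all_boot all_order all_algebra.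
From mathcomp Require Import all_fingroup all_solvable all_field.
From mathcomp Require Import boolp.
From mathcomp Require Import zify ring.

Set Implicit Arguments.
Unset Strict Implicit.
Unset Printing Implicit Defensive.

Import GRing.Theory.

Local Open Scope ring_scope.

(** Adjacency of two vertices depends only on their blocks, so the isomorphism is a matter of
    cardinalities: the number of blocks of each kind and the number of vertices in each block have
    to match, and [partition_bij] turns such matching numbers into a bijection compatible with the
    blocks. The subrings need not contain 1, which is why the zero ring and products such as 0 x K
    occur among the vertices. Identities are recovered by taking powers: in a field of order p^n,
    the exponent p^n - 1 turns nonzero elements into 1, which yields idempotents in products, while
    the exponent p^n erases the nilpotent part of a dual number. The corrections in [a'] for p = 2
    come from very small fields: GF(2) has a single generator and the two generators of GF(4) are
    conjugate, so neither GF(2) x GF(2) nor GF(4) x GF(4) is generated by one element. The kinds of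
    blocks are counted through incidences between quadratics and their roots rather than through
    discriminants, so that the argument is the same in every characteristic. *)

Lemma partition_bij (W W' T T' : finType) (h : W -> T) (h' : W' -> T')
    (s : T -> T') :
  bijective s ->
  (forall t, #|[set w | h w == t]| = #|[set w' | h' w' == s t]|) ->
  exists2 f : W -> W', bijective f & forall w, h' (f w) = s (h w).
Proof.
move=> [s' sK s'K] E.
pose A t := [set w | h w == t].
have wA w : w \in A (h w) by rewrite inE.
(* [w] goes to the element of the same rank in the fibre of [h'] over [s (h w)]. *)
pose f w := enum_val (cast_ord (E (h w)) (enum_rank_in (wA w) w)).
have hf w : h' (f w) = s (h w).
  by have := enum_valP (cast_ord (E (h w)) (enum_rank_in (wA w) w));
     rewrite inE => /eqP.
exists f => //.
have card_fin (X : finType) (k : X -> T) :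
    #|X| = (\sum_t #|[set w | k w == t]|)%N.
  rewrite -sum1_card (partition_big k predT) //=.
  by apply: eq_bigr => t _; rewrite -sum1_card; apply: eq_bigl => w; rewrite inE.
apply: inj_card_bij => [w v|].
  (* Two indices are kept apart because the ranks of [w] and [v] lie in ordinals that depend on
     their fibres; they become comparable once the indices are identified. *)
  have inj t t' (wt : w \in A t) (vt' : v \in A t') : t = t' ->
      enum_val (cast_ord (E t) (enum_rank_in wt w)) =
      enum_val (cast_ord (E t') (enum_rank_in vt' v)) -> w = v.
    move=> tt'; subst t' => /enum_val_inj/cast_ord_inj e.
    by rewrite -(enum_rankK_in wt wt) e enum_rankK_in.
  move=> fwv; apply: (inj _ _ (wA w) (wA v) _ fwv).
  by apply: (can_inj sK); rewrite -!hf fwv.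
rewrite (card_fin W' (s' \o h')) (card_fin W h); apply: eq_leq.
apply: eq_bigr => t _; rewrite E; apply: eq_card => w; rewrite !inE /=.
by rewrite (can2_eq s'K sK).
Qed.

Lemma card_seq (T : finType) (A : {set T}) (s : seq T) :
  uniq s -> (forall x, (x \in A) = (x \in s)) -> #|A| = size s.
Proof. by move=> us As; rewrite -(card_uniqP us); apply: eq_card. Qed.

(** * Subrings generated by one element *)

Section Subrng.
Variable R : finNzRingType.
Implicit Types (S : {set R}) (a b : R).

Definition fsub a : {set R} := [set b | `[< gen_subring a b >]].

Definition subrng S :=
  [/\ 0 \in S, {in S &, forall x y, x - y \in S}
    & {in S &, forall x y, x * y \in S}].

Lemma subrngD S : subrng S -> {in S &, forall x y, x + y \in S}.
Proof.
by move=> [S0 SB _] x y xS yS; rewrite -[y]opprK SB // -[- y]add0r SB.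
Qed.

Lemma subrngX S a k : subrng S -> a \in S -> (0 < k)%N -> a ^+ k \in S.
Proof.
move=> [_ _ SM] aS; case: k => // k _.
by elim: k => [|k IHk]; rewrite ?expr1 // exprS SM.
Qed.

Lemma subrngMz S a z : subrng S -> a \in S -> a *~ z \in S.
Proof.
move=> Sr aS; have [S0 SB _] := Sr.
have nat_mul n : a *+ n \in S.
  by elim: n => // n IHn; rewrite mulrS subrngD.
by case: z => n; [apply: nat_mul | rewrite NegzE mulrNz -[- _]add0r SB ?nat_mul].
Qed.

Lemma gen_subring_min S a b :
  subrng S -> a \in S -> gen_subring a b -> b \in S.
Proof.
move=> Sr aS [q /= q0 <-]; have [S0 _ _] := Sr.
rewrite horner_coef; elim/big_ind: _ => // [x y|[i _] _ /=]; first exact: subrngD.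
rewrite coef_map /=; case: i => [|i].
  by rewrite -horner_coef0 q0 mul0r.
by rewrite mulrzl subrngMz ?subrngX.
Qed.

Lemma mem_fsub a : a \in fsub a.
Proof. by rewrite inE; apply/asboolP/gen_subring_id. Qed.

Lemma fsub_subrng a : subrng (fsub a).
Proof.
split=> [|x y|x y].
- by rewrite inE; apply/asboolP; exists 0; rewrite /= ?rmorph0 ?horner0.
- rewrite !inE => /asboolP[q /= q0 <-] /asboolP[r /= r0 <-].
  apply/asboolP; exists (q - r); first by rewrite /= !hornerE q0 r0 subr0.
  by rewrite rmorphB hornerD hornerN.
- rewrite !inE => /asboolP[q /= q0 <-] /asboolP[r /= r0 <-].
  apply/asboolP; exists (q * r); first by rewrite /= hornerM q0 mul0r.
  rewrite rmorphM hornerM_comm // /comm_poly.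
  have ca : (map_poly intr r).[a] * a = a * (map_poly intr r).[a].
    by apply/esym/horner_intr_comm.
  by rewrite ca.
Qed.

Lemma fsub_min S a : subrng S -> a \in S -> fsub a \subset S.
Proof.
by move=> Sr aS; apply/subsetP=> b; rewrite inE => /asboolP; apply: gen_subring_min.
Qed.

Lemma fsub_eqP a b : fsub a = fsub b <-> gen_subring a = gen_subring b.
Proof.
split=> [ab|ab]; last by apply/setP=> x; rewrite !inE ab.
apply/funext => x; apply/propext.
apply: asbool_eq_equiv.
by have := congr1 (fun A : {set R} => x \in A) ab; rewrite /= !inE.
Qed.

End Subrng.

(** The image of [fsub a] is a subring containing [f a], and the preimage of [fsub (f a)] is a
    subring containing [a]. The map may be non-unital, such as y -> (0, y). *)
Lemma fsub_morph (R R' : finNzRingType) (f : R -> R') (a : R) :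
  {morph f : x y / x - y} -> {morph f : x y / x * y} ->
  fsub (f a) = f @: fsub a.
Proof.
move=> fB fM; have f0 : f 0 = 0 by rewrite -[0]subr0 fB subrr.
have [s0 sB sM] := fsub_subrng a; have [t0 tB tM] := fsub_subrng (f a).
apply/eqP; rewrite eqEsubset fsub_min ?imset_f ?mem_fsub //=; last first.
  split.
  - by apply/imsetP; exists 0.
  - by move=> _ _ /imsetP[x xs ->] /imsetP[y ys ->]; rewrite -fB imset_f ?sB.
  - by move=> _ _ /imsetP[x xs ->] /imsetP[y ys ->]; rewrite -fM imset_f ?sM.
have pre x : (x \in f @^-1: fsub (f a)) = (f x \in fsub (f a)) by rewrite in_set.
rewrite sub_imset_pre fsub_min ?pre ?mem_fsub //.
split; first by rewrite pre f0.
  by move=> x y; rewrite !pre fB => xt yt; rewrite tB.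
by move=> x y; rewrite !pre fM => xt yt; rewrite tM.
Qed.

HB.instance Definition _ (R S : finNzRingType) := GRing.NzRing.on (R * S)%type.

(** * Subfields of a finite field *)

Definition frobfix (F : finFieldType) (p d : nat) : {set F} :=
  [set x | x ^+ (p ^ d) == x].

(** [frobfix F p 0] would be all of [F]. The index 0 is used for the zero ring instead, so that the
    cardinality is p^d for d = 0 as well as for the divisors of n. *)
Definition frobfix0 (F : finFieldType) (p d : nat) : {set F} :=
  if d == 0%N then [set 0] else frobfix F p d.

Section FiniteField.
Variables (F : finFieldType) (p n : nat).
Hypotheses (n_gt0 : (0 < n)%N) (p_pr : prime p) (cardF : #|F| = (p ^ n)%N).
Local Notation K d := (frobfix F p d).
Local Notation K0 d := (frobfix0 F p d).
Implicit Types (x y a b : F) (S : {set F}).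

Let p_gt1 := prime_gt1 p_pr.
Let p_gt0 := prime_gt0 p_pr.

Lemma pcharF : p \in [pchar F].
Proof. exact: card_finPcharP cardF p_pr. Qed.

Lemma pnat_pchar d : [pchar F].-nat (p ^ d)%N.
Proof. by rewrite pnatX pnatE // pcharF. Qed.

Lemma exprDp d x y : (x + y) ^+ (p ^ d) = x ^+ (p ^ d) + y ^+ (p ^ d).
Proof. by rewrite exprDn_pchar ?pnat_pchar. Qed.

Lemma exprBp d x y : (x - y) ^+ (p ^ d) = x ^+ (p ^ d) - y ^+ (p ^ d).
Proof. by rewrite exprDp exprNn_pchar ?pnat_pchar. Qed.

Lemma expr0p d : (0 : F) ^+ (p ^ d) = 0.
Proof. by rewrite expr0n gtn_eqF ?expn_gt0 ?p_gt0. Qed.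

Lemma exprp_inj d : injective (fun x => x ^+ (p ^ d)).
Proof.
move=> x y /eqP; rewrite -subr_eq0 -exprBp expf_eq0 subr_eq0.
by case/andP=> _ /eqP.
Qed.

Lemma frobfixP d x : reflect (x ^+ (p ^ d) = x) (x \in K d).
Proof. by rewrite inE; apply: eqP. Qed.

Lemma frobfix_0 d : 0 \in K d.
Proof. by rewrite inE expr0p. Qed.

Lemma frobfix_1 d : 1 \in K d.
Proof. by rewrite inE expr1n. Qed.

Lemma frobfix_subrng d : subrng (K d).
Proof.
split; first exact: frobfix_0.
  by move=> x y /frobfixP Kx /frobfixP Ky; apply/frobfixP; rewrite exprBp Kx Ky.
by move=> x y /frobfixP Kx /frobfixP Ky; apply/frobfixP; rewrite exprMn Kx Ky.
Qed.

Lemma frobfix_top x : x \in K n.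
Proof. by rewrite inE -cardF expf_card. Qed.

Lemma exp_frobfix d k x : x \in K d -> x ^+ (p ^ (k * d)) = x.
Proof.
move=> /frobfixP Kx; elim: k => [|k IHk]; first by rewrite mul0n expn0 expr1.
by rewrite mulSn expnD exprM Kx.
Qed.

Lemma frobfix_sub d e : (d %| e)%N -> K d \subset K e.
Proof.
by case/dvdnP=> k ->; apply/subsetP=> x Kx; apply/frobfixP/exp_frobfix.
Qed.

(** Bezout: with u d = v n + gcd and x fixed by the power p^(v n), the power p^gcd of x equals its
    power p^(u d), which is x. *)
Lemma frobfix_gcd d : (0 < d)%N -> K d = K (gcdn d n).
Proof.
move=> d_gt0; apply/eqP; rewrite eqEsubset (frobfix_sub (dvdn_gcdl d n)) andbT.
apply/subsetP=> x Kx; apply/frobfixP.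
case: (egcdnP n d_gt0) => u v eq_uv _.
rewrite -{1}(exp_frobfix v (frobfix_top x)) -exprM -expnD -eq_uv.
exact: exp_frobfix.
Qed.

Lemma prim_root_exists : {g : F | (p ^ n).-1.-primitive_root g}.
Proof.
apply/sigW.
have /hasP[g _ gP] : has (p ^ n).-1.-primitive_root (enum (predC1 (0 : F))).
  apply: cyclic.has_prim_root.
  - by rewrite -ltnS prednK ?expn_gt0 ?p_gt0 // -cardF finNzRing_gt1.
  - apply/allP=> x; rewrite mem_enum inE => x0; apply/unity_rootP.
    apply: (mulfI x0); rewrite -exprS prednK ?expn_gt0 ?p_gt0 // -cardF.
    by rewrite expf_card mulr1.
  - exact: enum_uniq.
  - by rewrite -cardE cardC1 cardF.
by exists g.
Qed.

Lemma frobfix_prim_root d : (d %| n)%N ->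
  exists2 g : F, (p ^ d).-1.-primitive_root g & g \in K d.
Proof.
case/dvdnP=> k nE; have [g gP] := prim_root_exists.
(* The exponent is the index of the multiplicative group of the subfield in that of [F]. *)
exists (g ^+ ((p ^ n).-1 %/ (p ^ d).-1)).
  by apply: dvdn_prim_root => //; rewrite nE mulnC expnM dvdn_pred_predX.
have /dvdnP[m mE] : ((p ^ d).-1 %| (p ^ n).-1)%N.
  by rewrite nE mulnC expnM dvdn_pred_predX.
have pd1 : (0 < (p ^ d).-1)%N.
  by case: (posnP (p ^ d).-1) (prim_order_gt0 gP) mE => // ->; rewrite muln0 => /[swap] ->.
apply/frobfixP; rewrite -[in LHS](prednK (n := p ^ d)) ?expn_gt0 ?p_gt0 //.
by rewrite exprS -[X in _ * X]exprM mE mulnK // -mE (prim_expr_order gP) mulr1.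
Qed.

Lemma pred_expn_gt0 d : (0 < d)%N -> (0 < (p ^ d).-1)%N.
Proof. by rewrite -(ltn_exp2l 0 d p_gt1) expn0; case: (p ^ d)%N => [|[]]. Qed.

Lemma frobfix_nz d x : x \in K d -> x != 0 -> x ^+ (p ^ d).-1 = 1.
Proof.
move=> /frobfixP Kx x0; apply: (mulfI x0).
by rewrite -exprS prednK ?expn_gt0 ?p_gt0 // Kx mulr1.
Qed.

Lemma card_frobfix d : (d %| n)%N -> #|K d| = (p ^ d)%N.
Proof.
move=> dn; have [g gP gK] := frobfix_prim_root dn.
have d_gt0 := dvdn_gt0 n_gt0 dn.
have g0 : g != 0 by rewrite (prim_root_eq0 gP) -lt0n pred_expn_gt0.
have -> : K d = 0 |: [set g ^+ i | i : 'I_(p ^ d).-1].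
  apply/setP=> x; rewrite in_setU1; have [->|x0] /= := eqVneq x 0.
    exact: frobfix_0.
  apply/idP/imsetP=> [Kx | [i _ ->]].
    by have [i ->] := prim_rootP gP (frobfix_nz Kx x0); exists i.
  have [->|i0] := posnP i; first by rewrite expr0 frobfix_1.
  by rewrite (subrngX (frobfix_subrng d)).
have -> : #|0 |: [set g ^+ i | i : 'I_(p ^ d).-1]| =
    (1 + #|[set g ^+ i | i : 'I_(p ^ d).-1]|)%N.
  rewrite cardsU1; congr (_ + _)%N; apply/eqP; rewrite eqb1; apply/imsetP=> -[i _].
  by move/esym/eqP; rewrite expf_eq0 (negPf g0) andbF.
rewrite card_imset ?card_ord ?prednK ?expn_gt0 ?p_gt0 //.
  by rewrite add1n prednK ?expn_gt0 ?p_gt0.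
move=> i j /eqP; rewrite (eq_prim_root_expr gP) !modn_small // => /eqP.
exact: val_inj.
Qed.

Lemma subrng_card_exp S : subrng S -> exists d, #|S| = (p ^ d)%N.
Proof.
move=> Sr; have gS : group_set S.
  apply/group_setP; split; first by case: Sr.
  by move=> x y Sx Sy; rewrite FinRing.zmodMgE subrngD.
have: (#|Group gS| %| #|[set: F]|)%N by rewrite cardSg ?subsetT.
by rewrite cardsT cardF => /(dvdn_pfactor _ _ p_pr)[d _ dE]; exists d.
Qed.

(** Fermat's argument: multiplication by a nonzero [x] of [S] permutes the nonzero elements of [S],
    and comparing their products gives x^(|S| - 1) = 1. *)
Lemma subrng_expf_card S x : subrng S -> x \in S -> x ^+ #|S| = x.
Proof.
move=> Sr Sx; have [S0 _ SM] := Sr; have [->|x0] := eqVneq x 0.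
  by rewrite expr0n gtn_eqF //; apply/card_gt0P; exists 0.
pose P := \prod_(y in S :\ 0) y.
have P0 : P != 0 by apply/prodf_neq0 => y; rewrite !inE => /andP[].
have mulS : [set x * y | y in S :\ 0] = S :\ 0.
  apply/eqP; rewrite eqEcard card_imset ?leqnn ?andbT; last exact: mulfI.
  apply/subsetP=> _ /imsetP[y /setD1P[y0 Sy] ->].
  by rewrite !inE mulf_neq0 //= SM.
have: P = x ^+ #|S :\ 0| * P.
  rewrite -{1}/P {1}/P -{1}mulS big_imset /=; last by move=> ? ? _ _; apply: mulfI.
  by rewrite big_split prodr_const.
rewrite -{1}[P]mul1r => /(mulIf P0) xE.
by rewrite (cardsD1 0 S) S0 exprS -xE mulr1.
Qed.

(** By Lagrange in the additive group, [S] has p^d elements, so it lies in [K d], which equals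
    [K (gcdn d n)] and has only p^gcd elements. Hence gcd = d, and the inclusion is an equality. *)
Lemma subrng_frobfix S : subrng S -> S != [set 0] ->
  exists2 d, (d %| n)%N & S = K d.
Proof.
move=> Sr S0; have [d dE] := subrng_card_exp Sr.
have sSK : S \subset K d.
  by apply/subsetP=> x Sx; apply/frobfixP; rewrite -dE subrng_expf_card.
have d_gt0 : (0 < d)%N.
  have [d0|//] := posnP d; move: S0; rewrite eq_sym eqEcard cards1 dE d0 andbT.
  by rewrite sub1set; case: Sr => ->.
have := subset_leq_card sSK.
rewrite (frobfix_gcd d_gt0) dE card_frobfix ?dvdn_gcdr // leq_exp2l // => le_d.
have gd : gcdn d n = d by apply/eqP; rewrite eqn_leq le_d dvdn_leq ?dvdn_gcdl.
have dn : (d %| n)%N by rewrite -gd dvdn_gcdr.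
by exists d => //; apply/eqP; rewrite eqEcard sSK card_frobfix // dE leqnn.
Qed.

Lemma fsub0 : fsub (0 : F) = [set 0].
Proof.
apply/eqP; rewrite eqEsubset sub1set mem_fsub andbT fsub_min ?set11 //.
split; rewrite ?set11 //.
  by move=> x y /set1P-> /set1P->; rewrite subr0 set11.
by move=> x y /set1P-> _; rewrite mul0r set11.
Qed.

Lemma fsub_frobfix a : a != 0 -> exists2 d, (d %| n)%N & fsub a = K d.
Proof.
move=> a0; apply: subrng_frobfix; first exact: fsub_subrng.
by apply: contraNneq a0 => e; have := mem_fsub a; rewrite e inE.
Qed.

Lemma frobfix_inj d e : (d %| n)%N -> (e %| n)%N -> K d = K e -> d = e.
Proof.
move=> dn en /(congr1 (fun A : {set F} => #|A|)) /eqP.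
by rewrite !card_frobfix // eqn_exp2l // => /eqP.
Qed.

Lemma frobfix0E d : (d %| n)%N -> K0 d = K d.
Proof. by move/(dvdn_gt0 n_gt0); rewrite /frobfix0; case: d. Qed.

(** The generated subfield [K e] lies in [K d]; conversely g^(p^e - 1) = 1, so the order p^d - 1 of
    [g] divides p^e - 1, and d <= e. *)
Lemma fsub_prim_root d g : (d %| n)%N -> (p ^ d).-1.-primitive_root g ->
  g \in K d -> fsub g = K d.
Proof.
move=> dn gP gK; have d_gt0 := dvdn_gt0 n_gt0 dn.
have g0 : g != 0 by rewrite (prim_root_eq0 gP) -lt0n pred_expn_gt0.
have [e en eE] := fsub_frobfix g0; have e_gt0 := dvdn_gt0 n_gt0 en.
have sKK : K e \subset K d by rewrite -eE fsub_min //; apply: frobfix_subrng.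
apply/eqP; rewrite eE eqEcard sKK !card_frobfix // leq_exp2l //.
have gKe : g \in K e by rewrite -eE mem_fsub.
have := frobfix_nz gKe g0 => /eqP; rewrite -(prim_order_dvd gP).
move/(dvdn_leq (pred_expn_gt0 e_gt0)); rewrite -ltnS !prednK ?expn_gt0 ?p_gt0 //.
by rewrite leq_exp2l.
Qed.

Lemma frobfix_int x : x \in K 1 -> exists2 k : nat, (k < p)%N & x = k%:R.
Proof.
move=> Kx; have [p0 inj] : p%:R = 0 :> F /\
    {in [pred k | (k < p)%N] &, injective (fun k : nat => k%:R : F)}.
  have := pcharF; rewrite inE p_pr => /eqP p0; split=> // i j.
  wlog ij : i j / (i <= j)%N => [W|] ip jp eqij.
    by case/orP: (leq_total i j) => /W-> //.
  apply/eqP; rewrite eqn_leq ij /=.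
  move/eqP: eqij; rewrite eq_sym -subr_eq0 -natrB // -(dvdn_pcharf pcharF).
  case: (posnP (j - i)) => [|ji /dvdn_leq]; first by move/eqP; rewrite subn_eq0.
  move=> /(_ ji); move: jp; rewrite inE; lia.
pose A : {set F} := [set (k%:R : F) | k : 'I_p].
suff: x \in A by case/imsetP=> k _ ->; exists k.
suff -> : A = K 1 by [].
apply/eqP; rewrite eqEcard card_frobfix ?dvd1n // expn1 card_imset ?card_ord ?leqnn ?andbT.
  apply/subsetP=> _ /imsetP[k _ ->]; apply/frobfixP; rewrite expn1.
  by rewrite -[LHS](pFrobenius_autE pcharF) pFrobenius_aut_nat.
by move=> i j /inj e; apply/val_inj/e; rewrite inE.
Qed.

End FiniteField.

(** * Conjugate elements and integral polynomials *)

Lemma horner_intr_morph (R R' : nzRingType) (f : {rmorphism R -> R'})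
    (q : {poly int}) (a : R) :
  (map_poly intr q).[f a] = f (map_poly intr q).[a].
Proof.
rewrite -horner_map -map_poly_comp; congr _.[_].
by apply: eq_map_poly => z; rewrite /= rmorph_int.
Qed.

Section Pairs.
Variables (F : finFieldType) (p n : nat).
Hypotheses (n_gt0 : (0 < n)%N) (p_pr : prime p) (cardF : #|F| = (p ^ n)%N).
Local Notation K d := (frobfix F p d).
Implicit Types (x y a b : F) (S : {set F}).

Let p_gt1 := prime_gt1 p_pr.
Let p_gt0 := prime_gt0 p_pr.
Let fK := fsub_frobfix n_gt0 p_pr cardF.

(* The minimal polynomial [\prod_k ('X - a ^+ (p ^ k))] is Frobenius-invariant,
   hence lifts to an integral polynomial. *)
Lemma separating_poly a b : b != 0 -> (forall k, b != a ^+ (p ^ k)) ->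
  exists q : {poly int}, [/\ q.[0] = 0, (map_poly intr q).[a] = 0
    & (map_poly intr q).[b] != 0].
Proof.
move=> b0 abN.
have chF := pcharF p_pr cardF.
pose m := \prod_(k < n) ('X - (a ^+ (p ^ k))%:P).
(* Frobenius sends each factor to the next one and the last to the first, since a^(p^n) = a. The
   coefficients therefore lie in the prime field. *)
have mF : map_poly (pFrobenius_aut chF) m = m.
  rewrite rmorph_prod /m; have := frobfix_top cardF a; rewrite inE => /eqP.
  case: (n) n_gt0 => // n' _ aq; rewrite big_ord_recr [RHS]big_ord_recl /=.
  rewrite mulrC; congr (_ * _).
    by rewrite map_polyXsubC /= pFrobenius_autE -exprM -expnSr aq expn0 expr1.
  apply: eq_bigr => i _.
  by rewrite map_polyXsubC /= pFrobenius_autE -exprM -expnSr.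
have /boolp.choice[c cE] : forall i, exists k : nat, m`_i = k%:R.
  move=> i; have [|k _ ->] := @frobfix_int F p n n_gt0 p_pr cardF m`_i; last by exists k.
  by rewrite inE expn1 -[X in X == _](pFrobenius_autE chF) -coef_map mF.
pose r : {poly int} := \poly_(i < size m) (c i)%:R.
have rE : map_poly intr r = m.
  apply/polyP=> i; rewrite coef_map coef_poly /= cE; case: ltnP => // le_i.
    by rewrite rmorph_nat.
  by rewrite -cE nth_default // rmorph0.
have qE x : (map_poly intr ('X * r)).[x] = x * m.[x].
  by rewrite rmorphM /= map_polyX rE hornerM hornerX.
(* The factor ['X] removes the constant term, and it does not vanish at [b] because [b] is
   nonzero. *)
exists ('X * r); rewrite !qE hornerM hornerX mul0r; split=> //.
  rewrite horner_prod; case: (n) n_gt0 => // n' _; rewrite big_ord_recl /=.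
  by rewrite !hornerE expn0 expr1 subrr /= mulr0 mul0r.
rewrite mulf_neq0 // horner_prod; apply/prodf_neq0 => k _.
by rewrite !hornerE subr_eq0.
Qed.

Lemma exprp_morphB k : {morph (fun x => x ^+ (p ^ k)) : x y / x - y}.
Proof. by move=> x y; rewrite (exprBp p_pr cardF). Qed.

(** A power of Frobenius maps [fsub a] into itself, hence onto itself by injectivity and
    finiteness. *)
Lemma fsub_exprp a k : fsub (a ^+ (p ^ k)) = fsub a.
Proof.
rewrite (@fsub_morph F F (fun x => x ^+ (p ^ k))); last first.
- by move=> x y; rewrite exprMn.
- exact: exprp_morphB.
apply/eqP; rewrite eqEcard card_imset ?leqnn ?andbT; last exact: (exprp_inj p_pr cardF).
apply/subsetP=> _ /imsetP[x xa ->].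
by apply: subrngX (fsub_subrng a) xa _; rewrite expn_gt0 p_gt0.
Qed.

Lemma frobfix_sub_eq a d : (d %| n)%N -> a != 0 -> a \in K d -> (p ^ d <= #|fsub a|)%N ->
  fsub a = K d.
Proof.
move=> dn a0 aK le; apply/eqP; rewrite eqEcard (fsub_min (frobfix_subrng p_pr cardF d)) //=.
by rewrite (card_frobfix n_gt0 p_pr cardF dn).
Qed.

Lemma fsub_frobfix1 a : a != 0 -> a \in K 1 -> fsub a = K 1.
Proof.
move=> a0 Ka; apply: frobfix_sub_eq; rewrite ?dvd1n //.
have [d dn ->] := fK a0; rewrite (card_frobfix n_gt0 p_pr cardF dn) leq_exp2l //.
exact: dvdn_gt0 dn.
Qed.

End Pairs.

(** * Generated subrings of a product of two fields *)

(** The products of two subfields that no pair (a, b) with a != b generates: for d = e = 0 only (0,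
    0) is available; for p = 2 and d = e = 1 only (1, 1); for p = d = e = 2 the two generators of
    GF(4) are equal or conjugate, so that a graph is generated instead. *)
Definition split_bad (p d e : nat) : bool :=
  (d == e) && ((d == 0%N) || ((p == 2%N) && (d <= 2)%N)).

(* [(d, e, 0)] stands for a product of two subfields (with [d = 0] for the zero
   ring) and [(d, d, k)], [0 < k], for the graph of an automorphism. *)
Definition split_codes (p n : nat) : seq (nat * nat * nat) :=
  [seq (x, 0%N) | x <- [seq (d, e) | d <- 0%N :: divisors n, e <- 0%N :: divisors n]
                  & ~~ split_bad p x.1 x.2] ++
  [seq (d, d, k) | d <- divisors n, k <- iota 1 d.-1].

Lemma mem_split_codes p n d e k : (0 < n)%N ->
  reflect ([/\ k = 0%N, (d == 0%N) || (d %| n)%N, (e == 0%N) || (e %| n)%N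
             & ~~ split_bad p d e]
           \/ [/\ e = d, (d %| n)%N & (0 < k < d)%N])
    ((d, e, k) \in split_codes p n).
Proof.
move=> n_gt0; rewrite mem_cat; apply: (iffP orP) => -[].
- case/mapP=> -[d' e']; rewrite mem_filter => /andP[nb /allpairsPdep[u [v [ud ve e1]]]] [-> -> ->].
  left; case: e1 nb ud ve => -> -> nb; rewrite !inE -!dvdn_divisors //.
- case/allpairsPdep=> d' [k' [d'n k'd [-> -> ->]]]; right.
  move: k'd d'n; rewrite mem_iota -dvdn_divisors // => k'd d'n; split=> //; lia.
- case=> -> dn en nb; left; apply/mapP; exists (d, e) => //.
  rewrite mem_filter; apply/andP; split=> //; apply/allpairsPdep; exists d, e.
  by rewrite !inE -!dvdn_divisors.
- case=> -> dn kd; right; apply/allpairsPdep; exists d, k.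
  by rewrite -dvdn_divisors // mem_iota; split=> //; lia.
Qed.

Lemma uniq_split_codes p n : uniq (split_codes p n).
Proof.
have du := divisors_uniq n.
have d0 : uniq (0%N :: divisors n).
  by rewrite /= du andbT; case: n {du} => // n; rewrite -dvdn_divisors.
rewrite cat_uniq; apply/and3P; split.
- rewrite map_inj_uniq; last by move=> x y [].
  apply/filter_uniq/allpairs_uniq => //.
  by move=> [a1 b1] [a2 b2] _ _ /= [-> ->].
- apply/hasPn=> t /allpairsPdep[d [k [_ k_d ->]]]; apply/mapP=> -[x _ [_ k0]].
  by move: k_d; rewrite k0 mem_iota.
- apply: allpairs_uniq_dep => //; first by move=> d _; apply: iota_uniq.
  by move=> [a1 b1] [a2 b2] _ _ /= [-> _ ->].
Qed.

(** There are (d(n) + 1)^2 products, from which the bad ones are removed, and the automorphism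
    graphs contribute the sum of d - 1 over the divisors d, that is sigma(n) - d(n). The number of
    bad products is 1 for p > 2; for p = 2 it is 2 or 3 according to whether 2 divides n. *)
Lemma size_split_codes p n : (0 < n)%N -> size (split_codes p n) = a' p n.
Proof.
move=> n_gt0; set D := divisors n; set s := size D.
have du : uniq D := divisors_uniq n.
have d0 : 0%N \notin D by rewrite -dvdn_divisors // dvd0n -lt0n.
have u0 : uniq (0%N :: D) by rewrite /= du d0.
pose bad d := (d == 0%N) || ((p == 2%N) && (d <= 2)%N).
rewrite size_cat size_map size_filter size_allpairs_dep.
have -> : sumn [seq size (iota 1 d.-1) | d <- D] = (\sum_(d <- D) d.-1)%N.
  by rewrite sumnE big_map; apply: eq_bigr => d _; rewrite size_iota.
have sumE : ((\sum_(d <- D) d.-1) + s = sum_divisors n)%N.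
  rewrite /s -sum1_size -big_split /=; apply: eq_big_seq => d dD.
  by rewrite addn1 prednK //; move: d0; case: d dD => // ->.
have cE : count (fun x => split_bad p x.1 x.2) [seq (d, e) | d <- 0%N :: D, e <- 0%N :: D]
    = count bad (0%N :: D).
  rewrite -sum1_count big_mkcond big_allpairs -sum1_count [RHS]big_mkcond /=.
  apply: eq_big_seq => d dD; rewrite /= /split_bad -/(bad d).
  (* Bad pairs are diagonal, so each [d] contributes at most one of them. *)
  transitivity (\sum_(e <- 0%N :: D | e == d) (if bad d then 1 else 0))%N.
    rewrite [RHS]big_mkcond; apply: eq_bigr => e _; rewrite eq_sym.
    by case: eqP.
  by rewrite big_const_seq iter_addn_0 count_uniq_mem // dD muln1.
have szE : size [seq (d, e) | d <- 0%N :: D, e <- 0%N :: D] = (s.+1 * s.+1)%N.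
  by rewrite size_allpairs.
have := count_predC (fun x => split_bad p x.1 x.2) [seq (d, e) | d <- 0%N :: D, e <- 0%N :: D].
rewrite cE szE; set good := count (predC _) _ => cP.
have c12 : (p == 2%N) -> count bad (0%N :: D) = (if odd n then 2 else 3)%N.
  move=> p2; rewrite [LHS]/(1 + count bad D)%N; have -> : count bad D = count (mem [:: 1; 2]%N) D.
    apply: eq_in_count => d dD; rewrite /bad p2 /= !inE.
    by move: d0; case: d dD => [->//|[|[|d]]].
  have -> : count (mem [:: 1; 2]%N) D = (count_mem 1%N D + count_mem 2%N D)%N.
    rewrite -count_predUI addnC (@eq_count _ (predI _ _) pred0) ?count_pred0.
      by apply: eq_count => d; rewrite /= !inE.
    by move=> [|[|d]].
  rewrite !count_uniq_mem // -!dvdn_divisors // dvd1n dvdn2; by case: odd.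
have cn2 : (p != 2%N) -> count bad (0%N :: D) = 1%N.
  move=> /negPf p2; rewrite [LHS]/(1 + count bad D)%N (@eq_in_count _ bad pred0) ?count_pred0 //.
  by move=> d dD; rewrite /bad p2 orbF; apply/negbTE; apply: contraNneq d0 => <-.
rewrite /a' /num_divisors -/D -/s -sumE -mulnn.
rewrite -[X in (X + _ = _)%N]/good; move: (\sum_(d <- D) _)%N => t.
case: eqP => [/eqP/c12|/eqP/cn2] cb; last by rewrite cb in cP; lia.
by move: cP; rewrite cb; case: odd; lia.
Qed.

Section PairSubrings.
Variables (F : finFieldType) (p n : nat).
Hypotheses (n_gt0 : (0 < n)%N) (p_pr : prime p) (cardF : #|F| = (p ^ n)%N).
Local Notation K d := (frobfix F p d).
Local Notation K0 d := (frobfix0 F p d).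
Implicit Types (x y a b : F).

Let fK := fsub_frobfix n_gt0 p_pr cardF.

Definition split_decode (t : nat * nat * nat) : {set F * F} :=
  let: (d, e, k) := t in
  if k == 0%N then setX (K0 d) (K0 e) else [set (x, x ^+ (p ^ k)) | x in K d].

Lemma fsub_frobfix0 a :
  exists2 d, (d == 0%N) || (d %| n)%N & fsub a = K0 d.
Proof.
have [->|/fK[d dn ->]] := eqVneq a 0; first by exists 0%N; rewrite ?fsub0.
by exists d; rewrite ?dn ?orbT // (frobfix0E _ _ n_gt0).
Qed.

Lemma fsub_pair0l b : fsub (0 : F, b) = setX [set 0] (fsub b).
Proof.
rewrite (@fsub_morph F (F * F)%type (fun y => (0, y))); last first.
- by move=> x y; congr (_, _); rewrite mulr0.
- by move=> x y; congr (_, _); rewrite subr0.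
apply/setP=> -[x y]; rewrite in_setX in_set1; apply/imsetP/andP => [[z zb [-> ->]]|[/eqP-> yb]].
  by rewrite eqxx.
by exists y.
Qed.

Lemma fsub_pair0r a : fsub (a, 0 : F) = setX (fsub a) [set 0].
Proof.
rewrite (@fsub_morph F (F * F)%type (fun y => (y, 0))); last first.
- by move=> x y; congr (_, _); rewrite mulr0.
- by move=> x y; congr (_, _); rewrite subr0.
apply/setP=> -[x y]; rewrite in_setX in_set1; apply/imsetP/andP => [[z zb [-> ->]]|[xa /eqP->]].
  by rewrite eqxx.
by exists x.
Qed.

Lemma fsub_pair_conj a k :
  fsub (a, a ^+ (p ^ k)) = [set (x, x ^+ (p ^ k)) | x in fsub a].
Proof.
rewrite (@fsub_morph F (F * F)%type (fun x => (x, x ^+ (p ^ k)))) //.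
- by move=> x y; congr (_, _); rewrite (exprBp p_pr cardF).
- by move=> x y; congr (_, _); rewrite exprMn.
Qed.

Lemma exp_pred_card x : x != 0 -> x ^+ (p ^ n).-1 = 1.
Proof. by apply/(frobfix_nz p_pr)/(frobfix_top cardF). Qed.

(** A polynomial that kills [a] but not [b] puts (0, y) with y != 0 in the subring; its power p^n -
    1 is the idempotent (0, 1). As (1, 1) is obtained from (a, b) in the same way, (1, 0) follows,
    and the subring splits as a product. *)
Lemma fsub_pair_nonconj a b : a != 0 -> b != 0 ->
  (forall k, b != a ^+ (p ^ k)) -> fsub (a, b) = setX (fsub a) (fsub b).
Proof.
move=> a0 b0 abN; set S := fsub (a, b).
have Sr : subrng S := fsub_subrng _; have [S0 SB SM] := Sr.
have [a0' aB aM] := fsub_subrng a; have [b0' bB bM] := fsub_subrng b.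
have N_gt0 : (0 < (p ^ n).-1)%N := pred_expn_gt0 p_pr n_gt0.
have [q [q0 qa qb]] := separating_poly n_gt0 p_pr cardF b0 abN.
have Sab : (a, b) \in S := mem_fsub _.
have pairX (u v : F) i : (u, v) ^+ i = (u ^+ i, v ^+ i).
  by elim: i => // i IHi; rewrite !exprS IHi.
have pB (u v u' v' : F) : (u, v) - (u', v') = (u - u', v - v') by [].
have pM (u v u' v' : F) : (u, v) * (u', v') = (u * u', v * v') by [].
have pD (u v u' v' : F) : (u, v) + (u', v') = (u + u', v + v') by [].
have S11 : (1, 1) \in S.
  by have := subrngX Sr Sab N_gt0; rewrite pairX !exp_pred_card.
have S01 : (0, 1) \in S.
  have: (0, (map_poly intr q).[b]) \in S.
    rewrite inE; apply/asboolP; exists q => //.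
    rewrite [LHS]surjective_pairing -qa; congr (_, _).
      by rewrite -(horner_intr_morph fst).
    by rewrite -(horner_intr_morph snd).
  by move/(subrngX Sr)/(_ N_gt0); rewrite pairX expr0n gtn_eqF // exp_pred_card.
have S10 : (1, 0) \in S.
  by have := SB _ _ S11 S01; rewrite pB subr0 subrr.
apply/eqP; rewrite eqEsubset; apply/andP; split.
  apply: fsub_min; last by rewrite in_setX !mem_fsub.
  split; first by rewrite in_setX a0' b0'.
    by move=> [x y] [x' y']; rewrite !in_setX => /andP[? ?] /andP[? ?]; rewrite aB ?bB.
  by move=> [x y] [x' y']; rewrite !in_setX => /andP[? ?] /andP[? ?]; rewrite aM ?bM.
clearbody S; have inl x : x \in fsub a -> (x, 0) \in S.
  have: fsub a \subset [set x | (x, 0) \in S].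
    apply: fsub_min; last first.
      by rewrite in_set; have := SM _ _ Sab S10; rewrite pM mulr1 mulr0.
    split=> [|u v|u v]; rewrite !in_set // => Su Sv.
      by have := SB _ _ Su Sv; rewrite pB subrr.
    by have := SM _ _ Su Sv; rewrite pM mulr0.
  by move/subsetP=> sub /sub; rewrite in_set.
have inr x : x \in fsub b -> (0, x) \in S.
  have: fsub b \subset [set x | (0, x) \in S].
    apply: fsub_min; last first.
      by rewrite in_set; have := SM _ _ Sab S01; rewrite pM mulr1 mulr0.
    split=> [|u v|u v]; rewrite !in_set // => Su Sv.
      by have := SB _ _ Su Sv; rewrite pB subrr.
    by have := SM _ _ Su Sv; rewrite pM mulr0.
  by move/subsetP=> sub /sub; rewrite in_set.
apply/subsetP=> -[x y]; rewrite in_setX => /andP[/inl Sx /inr Sy].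
by have := subrngD Sr Sx Sy; rewrite pD addr0 add0r.
Qed.

Lemma mod_frobfix d k x : x \in K d -> x ^+ (p ^ k) = x ^+ (p ^ (k %% d)).
Proof. by move=> Kx; rewrite {1}(divn_eq k d) expnD exprM exp_frobfix. Qed.

Lemma fsub_pair_code a b : a != b ->
  exists2 t, t \in split_codes p n & fsub (a, b) = split_decode t.
Proof.
move=> ab; have [a0|a0] := eqVneq a 0.
  have [e en eE] := fsub_frobfix0 b; rewrite a0 in ab *.
  exists (0%N, e, 0%N); last by rewrite /= fsub_pair0l eE.
  apply/mem_split_codes => //; left; split=> //.
  rewrite /split_bad /= andbT; apply: contraNneq ab => e0.
  by have := mem_fsub b; rewrite eE -e0 inE eq_sym.
have [b0|b0] := eqVneq b 0.
  have [d dn dE] := fsub_frobfix0 a; rewrite b0 in ab *.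
  exists (d, 0%N, 0%N); last by rewrite /= fsub_pair0r dE.
  apply/mem_split_codes => //; left; split=> //.
  rewrite /split_bad /=; apply: contraNN ab => /andP[/eqP d0 _].
  by have := mem_fsub a; rewrite dE d0 inE.
have [d dn dE] := fK a0; have [e en eE] := fK b0.
have [[k bE]|abN] := pselect (exists k, b = a ^+ (p ^ k)).
  have Ka : a \in K d by rewrite -dE mem_fsub.
  have d_gt0 := dvdn_gt0 n_gt0 dn.
  have k0 : (k %% d != 0)%N.
    apply: contraNneq ab => k0.
    by rewrite bE (mod_frobfix _ Ka) k0 expn0 expr1.
  exists (d, d, k %% d)%N.
    by apply/mem_split_codes => //; right; rewrite lt0n k0 ltn_mod.
  rewrite /= (negPf k0) bE fsub_pair_conj dE; apply: eq_in_imset => x Kx.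
  by rewrite (mod_frobfix k Kx).
have {}abN k : b != a ^+ (p ^ k) by apply: contra_notN abN => /eqP; exists k.
exists (d, e, 0%N); last first.
  by rewrite /= fsub_pair_nonconj // dE eE !(frobfix0E _ _ n_gt0).
apply/mem_split_codes => //; left; rewrite dn en !orbT; split=> //.
(* It remains to see that non-conjugate nonzero [a] and [b] never give a bad code, that is, to
   exclude d = e <= 2 with p = 2. For d = 1 both are 1; for d = 2 they are the two elements of order
   3, which Frobenius exchanges. *)
have d_gt0 := dvdn_gt0 n_gt0 dn.
apply/negP=> /andP[/eqP de /orP[/eqP d0|/andP[/eqP p2 d2]]]; first by rewrite d0 in d_gt0.
rewrite -de in eE en *; have [g gP gK] := frobfix_prim_root p_pr cardF dn.
have Ka : a \in K d by rewrite -dE mem_fsub.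
have Kb : b \in K d by rewrite -eE mem_fsub.
have [i aE] := prim_rootP gP (frobfix_nz p_pr Ka a0).
have [j bE] := prim_rootP gP (frobfix_nz p_pr Kb b0).
case d1: (d == 1%N).
  have pd : (p ^ d).-1 = 1%N by rewrite (eqP d1) p2.
  have : (i < 1)%N by rewrite -[X in (_ < X)%N]pd.
  have : (j < 1)%N by rewrite -[X in (_ < X)%N]pd.
  rewrite !ltnS !leqn0 => /eqP j0 /eqP i0.
  by have := abN 0%N; rewrite aE bE i0 j0 !expr0 eqxx.
have d2' : d = 2%N by lia.
have neq1 x : fsub x = K d -> x != 1.
  move=> xE; apply/eqP=> x1; have : fsub x = K 1.
    by apply: fsub_frobfix1 n_gt0 p_pr cardF _ _ _; rewrite x1 ?oner_eq0 ?frobfix_1.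
  by rewrite xE => /(frobfix_inj n_gt0 p_pr cardF dn (dvd1n _)); rewrite d2'.
have i0 : i != 0%N :> nat.
  by apply/eqP=> i0; have := neq1 _ dE; rewrite aE i0 expr0 eqxx.
have j0 : j != 0%N :> nat.
  by apply/eqP=> j0; have := neq1 _ eE; rewrite bE j0 expr0 eqxx.
have pd : (p ^ d).-1 = 3%N by rewrite d2' p2.
have i3 : (i < 3)%N by rewrite -[X in (_ < X)%N]pd.
have j3 : (j < 3)%N by rewrite -[X in (_ < X)%N]pd.
have [ij|ij] := eqVneq (i : nat) j.
  by have := abN 0%N; rewrite expn0 expr1 aE bE ij eqxx.
have := abN 1%N; rewrite expn1 aE bE -exprM (eq_prim_root_expr gP).
move: i3 j3 i0 j0 ij {aE bE}; move: (i : nat) (j : nat); rewrite pd p2.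
by move=> [|[|[|]]] // [|[|[|]]].
Qed.

End PairSubrings.

(** * The number of subrings of F x F generated by a non-diagonal pair *)

Section PairCount.
Variables (F : finFieldType) (p n : nat).
Hypotheses (n_gt0 : (0 < n)%N) (p_pr : prime p) (cardF : #|F| = (p ^ n)%N).
Local Notation K d := (frobfix F p d).
Local Notation K0 d := (frobfix0 F p d).
Implicit Types (x y a b : F).

Let p_gt1 := prime_gt1 p_pr.
Let subK d := frobfix_subrng p_pr cardF d.
Let cardK := card_frobfix n_gt0 p_pr cardF.
Let pfx_gt0 := pred_expn_gt0 p_pr.

Lemma fsub_gen d : (d %| n)%N ->
  exists g : F, [/\ (p ^ d).-1.-primitive_root g, g \in K d, g != 0 & fsub g = K d].
Proof.
move=> dn; have [g gP gK] := frobfix_prim_root p_pr cardF dn; exists g.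
have g0 : g != 0 by rewrite (prim_root_eq0 gP) -lt0n pfx_gt0 // (dvdn_gt0 _ dn).
by split=> //; apply: fsub_prim_root dn gP gK.
Qed.

Lemma fsub_frobfix0_gen d : (d == 0%N) || (d %| n)%N ->
  exists2 g : F, fsub g = K0 d & (g == 0) = (d == 0%N).
Proof.
case/orP=> [/eqP->|dn]; first by exists 0; rewrite ?fsub0 ?eqxx.
have [g [_ _ g0 gE]] := fsub_gen dn; exists g; first by rewrite (frobfix0E _ _ n_gt0).
by rewrite (negPf g0) gtn_eqF // (dvdn_gt0 _ dn).
Qed.

Lemma frobfix0_inj d e : (d == 0%N) || (d %| n)%N -> (e == 0%N) || (e %| n)%N ->
  K0 d = K0 e -> d = e.
Proof.
have cK0 u : (u == 0%N) || (u %| n)%N -> #|K0 u| = (p ^ u)%N.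
  by case/orP=> [/eqP->|un]; rewrite ?cards1 ?expn0 ?(frobfix0E _ _ n_gt0) ?cardK.
move=> /cK0 dE /cK0 eE KE; apply/eqP.
by rewrite -(eqn_exp2l _ _ p_gt1) -dE -eE KE.
Qed.

(* For [d > 1], a generator and its inverse are conjugate only if [p = d = 2];
   for [d = 1], use [1] and [- 1]. *)
Lemma nonconj_pair d : (d %| n)%N -> ~~ split_bad p d d ->
  exists a b, [/\ a != 0, b != 0, fsub a = K d, fsub b = K d
                & forall k, b != a ^+ (p ^ k)].
Proof.
move=> dn; have d_gt0 := dvdn_gt0 n_gt0 dn.
rewrite /split_bad eqxx (gtn_eqF d_gt0) /= => nb.
have [d1|d1] := eqVneq d 1%N.
  have p2 : p != 2%N by move: nb; rewrite d1 andbT.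
  have m1 : (- 1 : F) \in K 1.
    by have [K0 KB _] := subK 1; rewrite -[- 1]add0r KB ?frobfix_1.
  exists 1, (- 1); rewrite oppr_eq0 !oner_eq0 d1.
  split=> // [||k]; try by apply: fsub_frobfix1 n_gt0 p_pr cardF _ _ _;
    rewrite ?oppr_eq0 ?oner_eq0 ?frobfix_1.
  rewrite expr1n eq_sym -subr_eq0 opprK -[_ + _]/(2%:R : F).
  rewrite -(dvdn_pcharf (pcharF p_pr cardF)) dvdn_prime2 //.
have [g [gP gK g0 gE]] := fsub_gen dn; exists g, g^-1; rewrite invr_eq0 g0.
have N_gt0 := pfx_gt0 d_gt0.
have VE : fsub g^-1 = K d.
  apply/eqP; rewrite eqEsubset; apply/andP; split.
    apply: fsub_min (subK d) _; rewrite inE exprVn.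
    by move: gK; rewrite inE => /eqP->.
  rewrite -gE; apply: fsub_min (fsub_subrng _) _.
  (* The subring generated by the inverse of [g] is a subfield, so it contains [g]. *)
  have [e en eE] := fsub_frobfix n_gt0 p_pr cardF (invr_neq0 g0).
  rewrite eE inE; have : g^-1 \in K e by rewrite -eE mem_fsub.
  by rewrite inE exprVn => /eqP/invr_inj->.
split=> // k; apply: contraNneq nb => gk.
(* If the inverse of [g] is a conjugate, the order p^d - 1 of [g] divides p^k' + 1 for some k' < d.
   Hence p^d <= p^(d - 1) + 2, which for d > 1 forces p = d = 2. *)
have : g ^+ (p ^ (k %% d)).+1 == 1.
  by rewrite exprSr -(mod_frobfix k gK) -gk mulVf.
rewrite -(prim_order_dvd gP) => /dvdn_leq le.
have {le} le : ((p ^ d).-1 <= (p ^ (k %% d)).+1)%N by apply: le.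
have kd : (p ^ (k %% d) <= p ^ d.-1)%N.
  by rewrite leq_exp2l // -ltnS prednK // ltn_mod.
have pd : (p ^ d = p * p ^ d.-1)%N by rewrite -expnS prednK.
have d_gt1 : (1 < d)%N by rewrite ltn_neqAle eq_sym d1.
have pP : (p <= p ^ d.-1)%N by rewrite -{1}(expn1 p) leq_exp2l // -ltnS prednK.
have le2 : (p * p ^ d.-1 <= p ^ d.-1 + 2)%N by lia.
have p2 : p = 2%N by move: p_gt1 pP le2; clear; nia.
rewrite p2 eqxx /=; move: le2; rewrite p2 leqNgt; apply: contraNT.
rewrite -ltnNge => d_gt2; have : (2 ^ 2 <= 2 ^ d.-1)%N by rewrite leq_exp2l //; lia.
lia.
Qed.

Lemma split_code_pair t : t \in split_codes p n ->
  exists2 ab : F * F, ab.1 != ab.2 & fsub ab = split_decode F p t.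
Proof.
case: t => -[d e] k /mem_split_codes => /(_ n_gt0)[[-> dn en nb]|[-> dn kd]].
  have [d0|d0] := eqVneq d 0%N.
    have [g gE g0] := fsub_frobfix0_gen en; exists (0, g); last first.
      by rewrite fsub_pair0l gE d0.
    by rewrite /= eq_sym g0; move: nb; rewrite /split_bad d0 /= andbT eq_sym.
  have [e0|e0] := eqVneq e 0%N.
    have [g gE g0] := fsub_frobfix0_gen dn; exists (g, 0); last first.
      by rewrite fsub_pair0r gE e0.
    by rewrite /= g0.
  rewrite (negPf d0) (negPf e0) /= in dn en.
  have [a [b [a0 b0 aE bE abN]]] : exists a b, [/\ a != 0, b != 0, fsub a = K d,
      fsub b = K e & forall k, b != a ^+ (p ^ k)].
    have [de|de] := eqVneq d e; first by rewrite -de in nb *; apply: nonconj_pair.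
    have [a [_ _ a0 aE]] := fsub_gen dn; have [b [_ _ b0 bE]] := fsub_gen en.
    (* Conjugate elements generate the same subfield, so for d != e any two generators will do. *)
    exists a, b; split=> // k'; apply: contraNneq de => bk.
    apply/eqP/(frobfix_inj n_gt0 p_pr cardF dn en).
    by rewrite -aE -bE bk (fsub_exprp p_pr cardF).
  exists (a, b); first by have := abN 0%N; rewrite expn0 expr1 eq_sym.
  by rewrite (fsub_pair_nonconj n_gt0 p_pr cardF) // aE bE /= !(frobfix0E _ _ n_gt0).
have [g [gP gK g0 gE]] := fsub_gen dn; exists (g, g ^+ (p ^ k)); last first.
  by rewrite (fsub_pair_conj p_pr cardF) gE /= gtn_eqF //; case/andP: kd.
rewrite /=; apply/eqP => gk; case/andP: kd => k_gt0 kd.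
have : g ^+ (p ^ k) == g ^+ 1 by rewrite expr1 -gk.
have lt_k : (p ^ k < p ^ d)%N by rewrite ltn_exp2l.
have lt_1k : (1 < p ^ k)%N by rewrite -(expn0 p) ltn_exp2l.
rewrite (eq_prim_root_expr gP) eqn_mod_dvd ?(ltnW lt_1k) // => /dvdn_leq; lia.
Qed.

(** A product contains (g, 0) and (0, h) for generators g, h of its factors; inside the graph of an
    injective additive map this forces g = h = 0, and the code (0, 0, 0) is bad. For a graph, [d] is
    read off from the first projection and [k] from the image of a primitive root. *)
Lemma split_decode_inj : {in split_codes p n &, injective (split_decode F p)}.
Proof.
have z0 d : 0 \in K0 d.
  by rewrite /frobfix0; case: eqP; rewrite ?set11 // frobfix_0.
have prodE d e d' e' : (d == 0%N) || (d %| n)%N -> (e == 0%N) || (e %| n)%N ->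
    (d' == 0%N) || (d' %| n)%N -> (e' == 0%N) || (e' %| n)%N ->
    setX (K0 d) (K0 e) = setX (K0 d') (K0 e') -> d = d' /\ e = e'.
  move=> dn en dn' en' XE; split; apply: frobfix0_inj => //; apply/setP=> x.
    have := congr1 (fun A : {set F * F} => (x, 0) \in A) XE.
    by rewrite /= !in_setX !z0 !andbT.
  have := congr1 (fun A : {set F * F} => (0, x) \in A) XE.
  by rewrite /= !in_setX !z0.
have mixN d e d' k : (d == 0%N) || (d %| n)%N -> (e == 0%N) || (e %| n)%N ->
    ~~ split_bad p d e -> setX (K0 d) (K0 e) <> [set (x, x ^+ (p ^ k)) | x in K d'].
  move=> dn en nb XE.
  have in_graph x y : x \in K0 d -> y \in K0 e -> y = x ^+ (p ^ k).
    move=> xd ye; have : (x, y) \in setX (K0 d) (K0 e) by rewrite in_setX xd.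
    by rewrite XE => /imsetP[z _ [-> ->]].
  have [g gE g0] := fsub_frobfix0_gen dn; have [h hE h0] := fsub_frobfix0_gen en.
  have := in_graph g 0; rewrite -gE mem_fsub z0 => /(_ isT isT)/esym/eqP.
  rewrite expf_eq0 => /andP[_]; rewrite g0 => /eqP d0.
  have := in_graph 0 h; rewrite -hE mem_fsub z0 => /(_ isT isT)/eqP.
  rewrite (expr0p _ p_pr) h0 => /eqP e0.
  by move: nb; rewrite d0 e0.
have graphE d d' k k' : (d %| n)%N -> (d' %| n)%N -> (0 < k < d)%N -> (0 < k' < d')%N ->
    [set (x, x ^+ (p ^ k)) | x in K d] = [set (x, x ^+ (p ^ k')) | x in K d'] ->
    d = d' /\ k = k'.
  move=> dn dn' kd kd' XE.
  have Kim u j : K u = [set xy.1 | xy in [set (x, x ^+ (p ^ j)) | x in K u]].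
    by rewrite -imset_comp; apply/setP=> x; apply/idP/imsetP=> [xK|[y yK ->//]]; exists x.
  have dd : d = d'.
    apply: (frobfix_inj n_gt0 p_pr cardF dn dn').
    by rewrite (Kim d k) (Kim d' k') XE.
  split=> //; have [g [gP gK g0 gE]] := fsub_gen dn.
  have : (g, g ^+ (p ^ k)) \in [set (x, x ^+ (p ^ k)) | x in K d] by rewrite imset_f.
  rewrite XE => /imsetP[_ _ [<-]] /eqP; rewrite (eq_prim_root_expr gP).
  (* The exponents p^j are below the order of [g], so equal powers of [g] have equal exponents. *)
  have lt_k j : (0 < j < d)%N -> (p ^ j < (p ^ d).-1)%N.
    case/andP=> j_gt0 jd; have : (p ^ j.+1 <= p ^ d)%N by rewrite leq_exp2l.
    have : (p <= p ^ j)%N by rewrite -{1}(expn1 p) leq_exp2l.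
    rewrite expnS; move: p_gt1 (p ^ j)%N (p ^ d)%N; clear; nia.
  rewrite !modn_small ?lt_k ?dd // -?dd // eqn_exp2l // => /eqP //.
move=> [[d e] k] [[d' e'] k'] /mem_split_codes => /(_ n_gt0)[].
- move=> [-> dn en nb] /mem_split_codes => /(_ n_gt0)[[-> dn' en' nb']|[-> dn' kd']].
    by move=> /= /prodE[] // -> ->.
  by rewrite /= gtn_eqF; [move/mixN; case | case/andP: kd'].
- move=> [-> dn kd] /mem_split_codes => /(_ n_gt0)[[-> dn' en' nb']|[-> dn' kd']].
    by rewrite /= gtn_eqF; [move/esym/mixN; case | case/andP: kd].
  have [k0 k0'] : (0 < k)%N /\ (0 < k')%N by case/andP: kd; case/andP: kd'.
  by rewrite /= !gtn_eqF // => /graphE[] // -> ->.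
Qed.

Lemma card_fsub_pairs :
  #|[set fsub ab | ab in [set ab : F * F | ab.1 != ab.2]]| = a' p n.
Proof.
rewrite -size_split_codes // -(size_map (split_decode F p)).
apply: card_seq.
  by rewrite map_inj_in_uniq ?uniq_split_codes //; apply: split_decode_inj.
move=> S; apply/imsetP/mapP => [[[a b]]|[t tC ->]].
  rewrite inE /= => ab ->.
  by have [t tC tE] := fsub_pair_code n_gt0 p_pr cardF ab; exists t.
by have [ab ab_neq <-] := split_code_pair tC; exists ab; rewrite ?inE.
Qed.

End PairCount.

(** * The number of subrings of a field generated by one element *)

Section FieldCount.
Variables (F : finFieldType) (p n : nat).
Hypotheses (n_gt0 : (0 < n)%N) (p_pr : prime p) (cardF : #|F| = (p ^ n)%N).
Local Notation K d := (frobfix F p d).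
Implicit Types (x y a b : F).

Let subK d := frobfix_subrng p_pr cardF d.

Lemma card_fsub_field : #|[set fsub x | x : F]| = (num_divisors n + 1)%N.
Proof.
have dn d : d \in 0%N :: divisors n -> (d == 0%N) || (d %| n)%N.
  by rewrite inE -dvdn_divisors.
have d0 : 0%N \notin divisors n by rewrite -dvdn_divisors // dvd0n -lt0n.
rewrite addn1 -[_.+1]/(size (0%N :: divisors n)) -(size_map (frobfix0 F p)).
apply: card_seq.
  rewrite map_inj_in_uniq; first by rewrite /= d0 divisors_uniq.
  by move=> d e /dn ? /dn ?; apply: (frobfix0_inj n_gt0 p_pr cardF).
move=> S; apply/imsetP/mapP => [[x _ ->]|[d /dn ddn ->]].
  have [d ddn ->] := fsub_frobfix0 n_gt0 p_pr cardF x.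
  by exists d; rewrite // inE -dvdn_divisors.
by have [x <- _] := fsub_frobfix0_gen n_gt0 p_pr cardF ddn; exists x.
Qed.

(** This serves for the quadratic extension of GF(p^n), with 2n in place of [n] and m = n: an
    element outside [K m] generates a subfield [K d] with d not dividing m, and every such subfield
    arises, because any generator of it lies outside [K m]. *)
Lemma card_fsub_notin m : (0 < m)%N ->
  #|[set fsub x | x in ~: K m]| = count (predC (dvdn^~ m)) (divisors n).
Proof.
move=> m_gt0; rewrite -size_filter -(size_map (frobfix F p)).
have sKm d : (d %| n)%N -> (K d \subset K m) = (d %| m)%N.
  move=> dn; apply/idP/idP => [sK|]; last exact: frobfix_sub.
  (* Bezout again, now with [d] and [m]. *)
  have e : K d = K (gcdn d m).
    apply/eqP; rewrite eqEsubset (frobfix_sub F p (dvdn_gcdl d m)) andbT.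
    apply/subsetP=> x xd; apply/frobfixP; have xm := subsetP sK _ xd.
    have [u v uv _] := egcdnP m (dvdn_gt0 n_gt0 dn).
    rewrite -{1}(exp_frobfix v xm) -exprM -expnD -uv.
    exact: exp_frobfix.
  rewrite (frobfix_inj n_gt0 p_pr cardF dn _ e) ?dvdn_gcdr //.
  exact: dvdn_trans (dvdn_gcdl _ _) dn.
apply: card_seq.
  rewrite map_inj_in_uniq ?filter_uniq ?divisors_uniq // => d e.
  rewrite !mem_filter -!dvdn_divisors // => /andP[_ dn] /andP[_ en].
  exact: (frobfix_inj n_gt0 p_pr cardF).
move=> S; apply/imsetP/mapP => [[x xm ->]|[d]].
  have x0 : x != 0.
    by apply: contraTneq xm => ->; rewrite in_setC negbK (frobfix_0 _ p_pr).
  have [d dn dE] := fsub_frobfix n_gt0 p_pr cardF x0; exists d => //.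
  rewrite mem_filter -dvdn_divisors // dn andbT /= -sKm // -dE.
  apply: contraTN xm => /subsetP/(_ x (mem_fsub x)).
  by rewrite in_setC negbK.
rewrite mem_filter -dvdn_divisors // => /andP[/= dm dn] ->.
have [g [_ gK _ gE]] := fsub_gen n_gt0 p_pr cardF dn; exists g => //.
rewrite in_setC; apply: contraNN dm => gm; rewrite -sKm // -gE.
exact: fsub_min (subK m) gm.
Qed.

End FieldCount.

Lemma count_divisors_double n : (0 < n)%N ->
  count (predC (dvdn^~ n)) (divisors (2 * n)) = c n.
Proof.
move=> n_gt0; rewrite /c /num_divisors -(count_predC (dvdn^~ n) (divisors (2 * n))).
suff -> : count (dvdn^~ n) (divisors (2 * n)) = size (divisors n) by rewrite addKn.
rewrite -size_filter; apply/perm_size/uniq_perm.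
- by rewrite filter_uniq ?divisors_uniq.
- exact: divisors_uniq.
move=> d; rewrite mem_filter -!dvdn_divisors ?muln_gt0 //=.
by apply: andb_idr => dn; apply: dvdn_mull.
Qed.

(** * Generated subrings of the dual numbers *)

Section DualNumbers.
Variables (F : finFieldType) (p n : nat).
Hypotheses (n_gt0 : (0 < n)%N) (p_pr : prime p) (cardF : #|F| = (p ^ n)%N).
Local Notation K d := (frobfix F p d).
Local Notation K0 d := (frobfix0 F p d).
(** [f x y] stands for x + y eps. The dual numbers are given only by these laws inside [R], so that
    a parametrised set of matrices can be plugged in directly. *)
Variables (R : finNzRingType) (f : F -> F -> R).
Hypothesis f_inj : forall x y x' y', f x y = f x' y' -> x = x' /\ y = y'.
Hypothesis fB : forall x y x' y', f x y - f x' y' = f (x - x') (y - y').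
Hypothesis fM : forall x y x' y', f x y * f x' y' = f (x * x') (x * y' + y * x').

Let p_gt0 := prime_gt0 p_pr.
Let subK d := frobfix_subrng p_pr cardF d.

Let f0 : f 0 0 = 0.
Proof. by rewrite -[in LHS](subrr (0 : F)) -fB subrr. Qed.

Let fD x y x' y' : f x y + f x' y' = f (x + x') (y + y').
Proof. by rewrite -[f x' y']opprK -[- f x' y']sub0r -f0 !fB !sub0r !opprK. Qed.

Let fX x y k : f x y ^+ k.+1 = f (x ^+ k.+1) (x ^+ k * y *+ k.+1).
Proof.
elim: k => [|k IHk]; first by rewrite !expr1 expr0 mul1r.
by rewrite exprS IHk fM -exprS [in RHS]mulrSr mulrnAr mulrA -exprS [y * _]mulrC.
Qed.

(** The maximum with 1 covers the case d = 0, where the scalar part is zero but the multiples of [m]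
    still range over the prime field. *)
Definition dual_subrng (d : nat) (m : F) : {set R} :=
  [set f xy.1 (xy.2 * m) | xy in setX (K0 d) (K (maxn d 1))].

Lemma dual_subrngP d m z :
  reflect (exists x y, [/\ x \in K0 d, y \in K (maxn d 1) & z = f x (y * m)])
          (z \in dual_subrng d m).
Proof.
apply: (iffP imsetP) => [[[x y]]|[x [y [xd yd ->]]]].
  by rewrite in_setX => /andP[xd yd] ->; exists x, y.
by exists (x, y); rewrite ?in_setX ?xd.
Qed.

Lemma frobfix0_sub d : K0 d \subset K (maxn d 1).
Proof.
rewrite /frobfix0; case: eqP => [->|/eqP d0]; first by rewrite sub1set frobfix_0.
by rewrite (maxn_idPl _) // lt0n.
Qed.

Lemma frobfix0_subrng d : subrng (K0 d).
Proof. by rewrite /frobfix0; case: eqP => // _; rewrite -fsub0; apply: fsub_subrng. Qed.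

Lemma dual_subrng_subrng d m : subrng (dual_subrng d m).
Proof.
have [K00 K0B K0M] := frobfix0_subrng d; have [K0' KB KM] := subK (maxn d 1).
have sK := subsetP (frobfix0_sub d).
split=> [|_ _ /dual_subrngP[x [y [xd yd ->]]] /dual_subrngP[x' [y' [xd' yd' ->]]]
         |_ _ /dual_subrngP[x [y [xd yd ->]]] /dual_subrngP[x' [y' [xd' yd' ->]]]];
  apply/dual_subrngP.
- by exists 0, 0; rewrite mul0r f0.
- by exists (x - x'), (y - y'); rewrite fB mulrBl K0B ?KB.
- exists (x * x'), (x * y' + y * x'); rewrite fM.
  split; first exact: K0M.
    by apply: (subrngD (subK _)); apply: KM => //; apply: sK.
  by congr (f _ _); ring.
Qed.

(** The power p^n of x + m eps is x, as its eps-coefficient is a multiple of p^n and x^(p^n) = x.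
    Thus x and m eps both belong to the subring, and their products and sums give the rest. *)
Lemma fsub_dual d x m : fsub x = K0 d -> m != 0 ->
  fsub (f x m) = dual_subrng d m.
Proof.
move=> xE m0; set S := fsub (f x m).
have Sr : subrng S := fsub_subrng _; have [S0 SB SM] := Sr.
have Sxm : f x m \in S := mem_fsub _.
apply/eqP; rewrite eqEsubset; apply/andP; split.
  apply: fsub_min (dual_subrng_subrng d m) _; apply/dual_subrngP.
  by exists x, 1; rewrite mul1r -xE mem_fsub frobfix_1.
clearbody S; have Sx : f x 0 \in S.
  have q_gt0 : (0 < p ^ n)%N by rewrite expn_gt0 p_gt0.
  have := subrngX Sr Sxm q_gt0; rewrite -(prednK q_gt0) fX prednK //.
  have /frobfixP -> := frobfix_top cardF x.
  have -> : x ^+ (p ^ n).-1 * m *+ p ^ n = 0; last by [].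
  rewrite -mulr_natr natrX; have /andP[_ /eqP->] := pcharF p_pr cardF.
  by rewrite expr0n (gtn_eqF n_gt0) mulr0.
have Sm : f 0 m \in S by have := SB _ _ Sxm Sx; rewrite fB subrr subr0.
have Sl y : y \in fsub x -> f y 0 \in S.
  have: fsub x \subset [set y | f y 0 \in S].
    apply: fsub_min; last by rewrite inE.
    split=> [|u v|u v]; rewrite !inE ?f0 // => Su Sv.
      by have := SB _ _ Su Sv; rewrite fB subrr.
    by have := SM _ _ Su Sv; rewrite fM mulr0 mul0r addr0.
  by move/subsetP=> sub /sub; rewrite in_set.
have Sr' y : y \in K (maxn d 1) -> f 0 (y * m) \in S.
  have [d0|d0] := posnP d.
    rewrite d0 => /(frobfix_int n_gt0 p_pr cardF)[k _ ->].
    elim: k => [|k IHk]; first by rewrite mul0r f0.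
    by have := subrngD Sr Sm IHk; rewrite fD addr0 mulrSr addrC mulrDl mul1r.
  rewrite (maxn_idPl d0) => yd; have /Sl Sy : y \in fsub x.
    by rewrite xE /frobfix0 gtn_eqF.
  by have := SM _ _ Sy Sm; rewrite fM mulr0 mul0r addr0.
apply/subsetP=> _ /dual_subrngP[u [v [ud vd ->]]]; rewrite -xE in ud.
by have := subrngD Sr (Sl _ ud) (Sr' _ vd); rewrite fD addr0 add0r.
Qed.

(** [dual_subrng d m] determines [m] exactly up to nonzero factors from the subfield, so for each
    [d] there is one subring per coset of the multiplicative group of that subfield. The
    representatives are g^j with j < [N d], the index. The value d = 0, where the subfield is the
    prime field, gives the separate first summand of [b']. *)
Lemma card_fsub_dual :
  #|[set fsub (f xm.1 xm.2) | xm in [set xm : F * F | xm.2 != 0]]| = b' p n.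
Proof.
have [g gP] := prim_root_exists p_pr cardF.
have pn_gt0 := pred_expn_gt0 p_pr n_gt0.
pose e d := maxn d 1; pose N d := ((p ^ n).-1 %/ (p ^ e d).-1)%N.
pose D := 0%N :: divisors n.
have DE d : d \in D = (d == 0%N) || (d %| n)%N by rewrite inE -dvdn_divisors.
have eN d : d \in D -> (e d %| n)%N.
  rewrite DE => /orP[/eqP->|dn]; first exact: dvd1n.
  by rewrite /e (maxn_idPl _) // (dvdn_gt0 _ dn).
have e_gt0 d : (0 < (p ^ e d).-1)%N.
  by apply: pred_expn_gt0; rewrite // leq_maxr.
have NE d : d \in D -> (N d * (p ^ e d).-1 = (p ^ n).-1)%N.
  move=> /eN/dvdnP[k nE]; rewrite /N divnK // nE.
  by rewrite mulnC expnM dvdn_pred_predX.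
have g0 : g != 0 by rewrite (prim_root_eq0 gP) -lt0n.
pose C := [seq (d, j) | d <- D, j <- iota 0 (N d)].
pose dec t := dual_subrng t.1 (g ^+ t.2).
have CP t : reflect (t.1 \in D /\ (t.2 < N t.1)%N) (t \in C).
  apply: (iffP allpairsPdep) => [[d [j [dD jN ->]]]|[tD tN]].
    by rewrite mem_iota in jN.
  by exists t.1, t.2; rewrite mem_iota -surjective_pairing.
have -> : b' p n = size (map dec C).
  rewrite size_map size_allpairs_dep sumnE big_map big_cons size_iota /b' !subn1.
  rewrite /N /e max0n expn1; congr (_ + _)%N; apply: eq_big_seq => d.
  rewrite -dvdn_divisors // => dn; rewrite size_iota subn1 (maxn_idPl _) //.
  exact: dvdn_gt0 dn.
apply: card_seq.
  rewrite map_inj_in_uniq.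
    apply: allpairs_uniq_dep => [|d _|]; last 1 first.
    - by move=> [a1 b1] [a2 b2] _ _ /= [-> ->].
    - rewrite /D /= divisors_uniq andbT -dvdn_divisors // dvd0n -lt0n //.
    - exact: iota_uniq.
  move=> [d j] [d' j'] /CP[/= dD jN] /CP[/= dD' jN'] TE.
  have dd : d = d'.
    apply: (frobfix0_inj n_gt0 p_pr cardF); rewrite -?DE //.
    have mem u i x : (x \in K0 u) = (f x 0 \in dual_subrng u (g ^+ i)).
      apply/idP/dual_subrngP => [xu|[x' [y' [xu yu /f_inj[-> _]]]]] //.
      by exists x, 0; rewrite mul0r frobfix_0.
    by apply/setP=> x; rewrite (mem d j) (mem d' j') -[dual_subrng d _]/(dec (d, j)) TE.
  rewrite -dd in jN' dD' TE *; congr (_, _).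
  have: f 0 (g ^+ j) \in dec (d, j').
    rewrite -TE; apply/dual_subrngP; exists 0, 1; rewrite mul1r frobfix_1.
    by have [] := frobfix0_subrng d.
  case/dual_subrngP=> x [y [_ yd /f_inj[_ gE]]].
  have y0 : y != 0.
    by apply/eqP=> y0; move/eqP: gE; rewrite y0 mul0r expf_eq0 (negPf g0) andbF.
  (* This power turns the factor [y] from the subfield into 1 and leaves exponents of [g] that are
     still below p^n - 1. *)
  have := congr1 (fun z => z ^+ (p ^ e d).-1) gE.
  rewrite /= exprMn (frobfix_nz p_pr yd y0) mul1r -!exprM => /eqP.
  rewrite (eq_prim_root_expr gP) !modn_small ?eqn_pmul2r //; first by move/eqP.
    by rewrite -(NE d dD) ltn_pmul2r.
  by rewrite -(NE d dD) ltn_pmul2r.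
move=> S; apply/imsetP/mapP => [[[x m]]|[[d j] /CP[/= dD jN] ->]]; last first.
  rewrite DE in dD; have [x xE _] := fsub_frobfix0_gen n_gt0 p_pr cardF dD.
  exists (x, g ^+ j); first by rewrite inE expf_neq0.
  by rewrite /= (fsub_dual xE) // expf_neq0.
rewrite inE /= => m0 ->.
have [d] := fsub_frobfix0 n_gt0 p_pr cardF x; rewrite -DE => dD xE.
have [i mE] := prim_rootP gP (frobfix_nz p_pr (frobfix_top cardF m) m0).
have N_gt0 : (0 < N d)%N.
  by have := NE d dD; case: (N d) => // e0; move: pn_gt0; rewrite -e0.
exists (d, i %% N d)%N; first by apply/CP; rewrite /= ltn_mod.
rewrite (fsub_dual xE m0) /dec /=.
(* The powers of [g] with exponent a multiple of [N d] lie in the subfield, so [u] can be absorbed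
   into the coefficient of eps. *)
set u := g ^+ (i %/ N d * N d); have mu : m = u * g ^+ (i %% N d).
  by rewrite mE {1}(divn_eq i (N d)) exprD.
have u0 : u != 0 by rewrite expf_neq0.
have uK : u \in K (e d).
  apply/frobfixP; rewrite -(prednK (n := p ^ e d)) ?expn_gt0 ?p_gt0 //.
  rewrite exprS -exprM -mulnA NE // mulnC exprM (prim_expr_order gP) expr1n.
  by rewrite mulr1.
have [_ _ KM] := subK (e d).
have uVK : u^-1 \in K (e d).
  by apply/frobfixP; rewrite exprVn; have /frobfixP -> := uK.
apply/setP=> z; apply/dual_subrngP/dual_subrngP => -[x' [y' [xd yd ->]]].
  by exists x', (y' * u); rewrite -mulrA -mu KM.
by exists x', (y' * u^-1); rewrite mu mulrA mulfVK ?KM.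
Qed.

End DualNumbers.

(** * Two by two matrices *)

Lemma ord2P (i : 'I_2) : i = 0 \/ i = 1.
Proof. by case: i => -[|[|//]] h; [left|right]; apply: val_inj. Qed.

Section Matrices.
Variable F : finFieldType.
Implicit Types (a b x y u v : F) (A B : 'M[F]_2).

Definition mx2 a b c d : 'M[F]_2 :=
  \matrix_(i, j) if i == 0 then (if j == 0 then a else b)
                 else (if j == 0 then c else d).

Lemma mx2K A : mx2 (A 0 0) (A 0 1) (A 1 0) (A 1 1) = A.
Proof.
apply/matrixP=> i j; rewrite mxE.
by case: (ord2P i) => ->; case: (ord2P j) => ->.
Qed.

Lemma mx2_inj a b c d a' b' c' d' :
  mx2 a b c d = mx2 a' b' c' d' -> [/\ a = a', b = b', c = c' & d = d'].
Proof.
move=> /matrixP E; have := E 0 0; have := E 0 1; have := E 1 0; have := E 1 1.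
by rewrite !mxE /=.
Qed.

Lemma mx2B a b c d a' b' c' d' :
  mx2 a b c d - mx2 a' b' c' d' = mx2 (a - a') (b - b') (c - c') (d - d').
Proof. by apply/matrixP=> i j; rewrite !mxE; do 2!case: ifP. Qed.

Lemma mx2M a b c d a' b' c' d' :
  mx2 a b c d * mx2 a' b' c' d' =
  mx2 (a * a' + b * c') (a * b' + b * d') (c * a' + d * c') (c * b' + d * d').
Proof.
apply/matrixP=> i j; rewrite !mxE !big_ord_recl big_ord0 addr0 !mxE /=.
by do 2!case: ifP.
Qed.

Lemma mx2_scalar a : a%:M = mx2 a 0 0 a.
Proof.
apply/matrixP=> i j; rewrite !mxE.
by case: (ord2P i) => ->; case: (ord2P j) => ->.
Qed.

(* The lines in the quotient of the 2x2 matrices by the scalars; each of them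
   is the set of non-scalar elements of a maximal commutative subalgebra. *)
Definition line : Type := (F * F + F + unit)%type.
HB.instance Definition _ := Finite.on line.

Definition line_vec (t : line) : F * F * F :=
  match t with
  (* Homogeneous coordinates normalised so that the last nonzero one in the order y, x, z is 1. *)
  | inl (inl (x, y)) => (x, y, 1)
  | inl (inr y) => (1, y, 0)
  | inr _ => (0, 1, 0)
  end.

Definition line_mx (t : line) (a b : F) : 'M[F]_2 :=
  let: (x, y, z) := line_vec t in mx2 (a + b * x) (b * y) (b * z) a.

Definition line_tr (t : line) : F := (line_vec t).1.1.
(** Minus the determinant of r = [line_mx t 0 1], so that Cayley-Hamilton reads r^2 = [line_tr t] r
    + [line_nm t]. *)
Definition line_nm (t : line) : F := (line_vec t).1.2 * (line_vec t).2.

Lemma line_vec_neq0 t : let: (x, y, z) := line_vec t in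
  [|| x != 0, y != 0 | z != 0].
Proof. by case: t => [[[x y]|y]|[]] /=; rewrite oner_eq0 ?orbT. Qed.

Lemma line_mxB t a b a' b' :
  line_mx t a b - line_mx t a' b' = line_mx t (a - a') (b - b').
Proof.
rewrite /line_mx; case: (line_vec t) => -[x y] z; rewrite mx2B.
by congr mx2; ring.
Qed.

Lemma line_mxM t a b a' b' : line_mx t a b * line_mx t a' b' =
  line_mx t (a * a' + b * b' * line_nm t) (a * b' + b * a' + b * b' * line_tr t).
Proof.
rewrite /line_mx /line_nm /line_tr; case: (line_vec t) => -[x y] z /=; rewrite mx2M.
by congr mx2; ring.
Qed.

Lemma line_mx_scalar t a : line_mx t a 0 = a%:M.
Proof.
by rewrite mx2_scalar /line_mx; case: (line_vec t) => -[x y] z; rewrite !mul0r addr0.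
Qed.

Lemma line_mx_inj t a b a' b' :
  line_mx t a b = line_mx t a' b' -> a = a' /\ b = b'.
Proof.
move=> E; have := line_vec_neq0 t; move: E; rewrite /line_mx.
case: (line_vec t) => -[x y] z /mx2_inj[e1 e2 e3 e4] nz; split=> //.
move: e1; rewrite e4 => /addrI e1.
by case/or3P: nz => /mulIf; apply.
Qed.

Definition line_of A : option line :=
  if A 1 0 != 0 then Some (inl (inl ((A 0 0 - A 1 1) / A 1 0, A 0 1 / A 1 0)))
  else if A 0 0 != A 1 1 then Some (inl (inr (A 0 1 / (A 0 0 - A 1 1))))
  else if A 0 1 != 0 then Some (inr tt) else None.

Lemma line_ofP A :
  match line_of A with
  | Some t => exists a b, b != 0 /\ A = line_mx t a b
  | None => exists a, A = a%:M
  end.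
Proof.
rewrite /line_of /line_mx; have := mx2K A.
move: (A 0 0) (A 0 1) (A 1 0) (A 1 1) => a b c d <-; case: eqVneq => [->|c0] /=; last first.
  by exists d, c; split=> //; congr mx2; field.
case: eqVneq => [->|ad] /=; last first.
  by exists d, (a - d); rewrite subr_eq0; split=> //; congr mx2; field; rewrite ?subr_eq0.
case: eqVneq => [->|b0] /=; first by exists d; rewrite mx2_scalar.
by exists d, b; split=> //; congr mx2; field.
Qed.

(** The entries of the commutator are, up to sign and the factor b b', the minors of the two
    coordinate vectors. Their vanishing makes the vectors proportional, and normalised proportional
    vectors are equal. *)
Lemma line_mx_comm t t' a b a' b' : b != 0 -> b' != 0 ->
  line_mx t a b * line_mx t' a' b' = line_mx t' a' b' * line_mx t a b -> t = t'.
Proof.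
move=> b0 b'0; rewrite /line_mx.
case E : (line_vec t) => [[x y] z]; case E' : (line_vec t') => [[x' y'] z'].
rewrite !mx2M => /mx2_inj[e1 e2 e3 _].
have eq_of_sub (l r l' r' : F) : l = r -> l' - r' = l - r -> l' = r'.
  by move=> -> /eqP; rewrite subrr subr_eq0 => /eqP.
have b2 : b * b' != 0 by rewrite mulf_neq0.
have yz : y * z' = y' * z by apply: (mulfI b2); apply: (eq_of_sub _ _ _ _ e1); ring.
have xy : x * y' = x' * y by apply: (mulfI b2); apply: (eq_of_sub _ _ _ _ e2); ring.
have xz : x * z' = x' * z by apply: (mulfI b2); apply: (eq_of_sub _ _ _ _ (esym e3)); ring.
move: E E'; case: t => [[[? ?]|?]|[]] /= [? ? ?]; case: t' => [[[? ?]|?]|[]] /= [? ? ?];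
  subst; move: xy yz xz; rewrite ?(mulr0, mul0r, mulr1, mul1r) => //.
- by move=> _ -> ->.
- by move=> _ _ /esym/eqP; rewrite oner_eq0.
- by move=> _ /esym/eqP; rewrite oner_eq0.
- by move=> _ _ /eqP; rewrite oner_eq0.
- by move->.
- by move=> /eqP; rewrite oner_eq0.
- by move=> _ /eqP; rewrite oner_eq0.
- by move=> /esym/eqP; rewrite oner_eq0.
Qed.

Lemma line_of_mx t a b : b != 0 -> line_of (line_mx t a b) = Some t.
Proof.
move=> b0; have := line_ofP (line_mx t a b); case: (line_of _) => [t'|].
  case=> a' [b' [b'0 E]]; congr Some; apply/esym/(line_mx_comm (a := a) (a' := a') b0 b'0).
  by rewrite -E.
by case=> a' /esym; rewrite -(line_mx_scalar t) => /line_mx_inj[_ /esym/eqP]; rewrite (negPf b0).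
Qed.

Lemma line_of_scalar a : line_of a%:M = None.
Proof.
have := line_ofP a%:M; case: (line_of _) => // t [a' [b' [b'0]]].
by rewrite -(line_mx_scalar t) => /line_mx_inj[_ /esym/eqP]; rewrite (negPf b'0).
Qed.

Lemma line_of_comm A B :
  A * B = B * A <-> [\/ line_of A = None, line_of B = None | line_of A = line_of B].
Proof.
have := line_ofP A; have := line_ofP B.
case: (line_of A) => [t|]; last first.
  by move=> _ [a ->]; split=> _; [constructor 1 | rewrite -!mulmxE scalar_mxC].
case: (line_of B) => [t'|]; last first.
  by move=> [a ->] _; split=> _; [constructor 2 | rewrite -!mulmxE scalar_mxC].
move=> [a' [b' [b'0 ->]]] [a [b [b0 ->]]]; split=> [/line_mx_comm-> //|].
  by constructor 3.
case=> // -[->]; rewrite !line_mxM; congr line_mx; ring.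
Qed.

End Matrices.

(** * The number of generated subrings in each kind of block *)

Section Lines.
Variables (F : finFieldType) (p n : nat).
Hypotheses (n_gt0 : (0 < n)%N) (p_pr : prime p) (cardF : #|F| = (p ^ n)%N).
Implicit Types (a b x y u v : F) (t : line F).

(* The eigenvalues of [line_mx t 0 1]. *)
Definition line_roots t : {set F} :=
  [set u | u * u == line_tr t * u + line_nm t].

Definition line_fsubs t : {set {set 'M[F]_2}} :=
  [set fsub A | A in [set A | line_of A == Some t]].

Lemma line_fsubsE t :
  line_fsubs t = [set fsub (line_mx t ab.1 ab.2) | ab in [set ab : F * F | ab.2 != 0]].
Proof.
apply/setP=> S; apply/imsetP/imsetP => [[A]|[[a b]]]; rewrite inE => tA ->.
  have := line_ofP A; rewrite (eqP tA) => -[a [b [b0 ->]]].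
  by exists (a, b); rewrite ?inE.
by exists (line_mx t a b); rewrite // inE line_of_mx.
Qed.

Lemma line_rootsE t u : u \in line_roots t -> line_roots t = [set u; line_tr t - u].
Proof.
rewrite inE => /eqP uu; apply/setP=> v; rewrite !inE.
have -> : (v * v == line_tr t * v + line_nm t) = ((v - u) * (v - (line_tr t - u)) == 0).
  rewrite -subr_eq0; congr (_ == 0).
  have -> : line_nm t = u * u - line_tr t * u by rewrite uu addrAC subrr add0r.
  by ring.
by rewrite mulf_eq0 !subr_eq0.
Qed.

Lemma card_line_roots_le t : (#|line_roots t| <= 2)%N.
Proof.
have [->|[u /line_rootsE->]] := set_0Vmem (line_roots t); first by rewrite cards0.
by rewrite cards2; case: eqP.
Qed.

Lemma card_line_fsubs2 t : #|line_roots t| = 2%N -> #|line_fsubs t| = a' p n.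
Proof.
have [->|[u ru]] := set_0Vmem (line_roots t); first by rewrite cards0.
rewrite (line_rootsE ru) cards2; case: eqVneq => // uv _; move: ru; rewrite inE => /eqP uu.
set v := line_tr t - u in uv.
have trE : line_tr t = u + v by rewrite /v addrCA subrr addr0.
have nmE : line_nm t = - (u * v) by rewrite /v mulrBr uu mulrC; ring.
have uv0 : u - v != 0 by rewrite subr_eq0.
(* The element a + b r with eigenvalues a + b u = l and a + b v = m; it is non-scalar exactly when l
   != m. *)
pose f (lm : F * F) := line_mx t (lm.1 - (lm.1 - lm.2) / (u - v) * u) ((lm.1 - lm.2) / (u - v)).
have f_inj : injective f.
  move=> [l m] [l' m'] /line_mx_inj[/= e1 e2]; move: e1; rewrite e2 => /addIr ll; subst l'.
  by move/(mulIf (invr_neq0 uv0))/addrI/oppr_inj: e2 => ->.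
have fB : {morph f : x y / x - y}.
  by move=> [l m] [l' m']; rewrite /f line_mxB /=; congr line_mx; field.
have fM : {morph f : x y / x * y}.
  by move=> [l m] [l' m']; rewrite /f line_mxM trE nmE /=; congr line_mx; field.
have -> : line_fsubs t = (fun S : {set F * F} => f @: S) @:
    [set fsub ab | ab in [set ab : F * F | ab.1 != ab.2]].
  rewrite line_fsubsE -imset_comp; apply/setP=> S.
  apply/imsetP/imsetP => -[[a b]]; rewrite inE /= => ab ->.
    exists (a + b * u, a + b * v).
      by rewrite inE /= (inj_eq (addrI _)) (inj_eq (mulfI ab)).
    rewrite -(fsub_morph _ fB fM); congr fsub; rewrite /f /=.
    by congr line_mx; field.
  exists ((a - (a - b) / (u - v) * u), ((a - b) / (u - v))).
    by rewrite inE /= mulf_neq0 ?invr_eq0 // subr_eq0.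
  by rewrite -(fsub_morph _ fB fM).
rewrite card_imset; last exact: imset_inj.
exact: card_fsub_pairs n_gt0 p_pr cardF.
Qed.

Lemma card_line_fsubs1 t : #|line_roots t| = 1%N -> #|line_fsubs t| = b' p n.
Proof.
have [->|[u ru]] := set_0Vmem (line_roots t); first by rewrite cards0.
rewrite (line_rootsE ru) cards2; case: eqVneq => // uv _; move: ru; rewrite inE => /eqP uu.
have trE : line_tr t = u + u by rewrite [X in _ + X]uv addrC subrK.
have nmE : line_nm t = - (u * u).
  have -> : line_nm t = u * u - line_tr t * u by rewrite uu addrAC subrr add0r.
  by rewrite trE; ring.
(* With a double root [u], eps = r - u has square zero, and l + m eps = (l - m u) + m r. *)
pose f l m := line_mx t (l - m * u) m.
rewrite -(@card_fsub_dual F p n n_gt0 p_pr cardF _ f).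
- rewrite line_fsubsE; congr #|pred_of_set _|; apply/setP=> S.
  apply/imsetP/imsetP => -[[a b]]; rewrite inE /= => b0 ->.
    by exists (a + b * u, b); rewrite ?inE // /f /= addrK.
  by exists (a - b * u, b); rewrite ?inE.
- by move=> x y x' y' /line_mx_inj[e1 e2]; move: e1; rewrite e2 => /addIr.
- by move=> x y x' y'; rewrite /f line_mxB; congr line_mx; ring.
- by move=> x y x' y'; rewrite /f line_mxM trE nmE; congr line_mx; ring.
Qed.

Lemma line_mxE t a b : line_mx t a b = a%:M + b *: line_mx t 0 1.
Proof.
rewrite /line_mx; case: (line_vec t) => -[x y] z; apply/matrixP=> i j; rewrite !mxE.
by case: (ord2P i) => ->; case: (ord2P j) => -> /=; ring.
Qed.

(** Without roots, the quadratic [h] is irreducible and F[X]/h is a field with p^(2n) elements.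
    Evaluation at r = [line_mx t 0 1] identifies it with the commutative subalgebra, scalars
    corresponding to the subfield of order p^n. *)
Lemma card_line_fsubs0 t : #|line_roots t| = 0%N -> #|line_fsubs t| = c n.
Proof.
move=> /cards0_eq r0.
pose h : {poly F} := 'X^2 - (line_tr t *: 'X + (line_nm t)%:P).
have lt_size : (size (line_tr t *: 'X + (line_nm t)%:P)%R < size ('X^2 : {poly F}))%N.
  rewrite size_polyXn ltnS (leq_trans (size_polyD _ _)) // geq_max.
  rewrite (leq_trans (size_scale_leq _ _)) ?size_polyX //.
  by rewrite (leq_trans (size_polyC_leq1 _)).
have hs : size h = 3%N by rewrite size_polyDl ?size_polyN // size_polyXn.
have hm : h \is monic.
  by rewrite monicE lead_coefDl ?size_polyN // lead_coefXn.
have hI : monic_irreducible_poly h.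
  split=> //; apply: cubic_irreducible; rewrite ?hs // => u; rewrite rootE.
  have: u \notin line_roots t by rewrite r0 inE.
  by rewrite inE -subr_eq0 /h !hornerE.
have hE : mk_monic h = h by rewrite /mk_monic hs hm.
pose L : finFieldType := {poly %/ h with hI}.
have cardL : #|L| = (p ^ (2 * n))%N.
  by rewrite card_qfpoly hs /= cardF -expnM mulnC.
have n2_gt0 : (0 < 2 * n)%N by rewrite muln_gt0.
pose r := line_mx t 0 1.
have h_r : horner_mx r h = 0.
  rewrite rmorphB rmorphXn rmorphD /= horner_mxZ horner_mx_X horner_mx_C.
  rewrite [_ + _%:M]addrC -line_mxE expr2 line_mxM line_mxB.
  rewrite (_ : _ - _ = 0); last by ring.
  rewrite (_ : _ - _ = 0); last by ring.
  by rewrite line_mx_scalar raddf0.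
have qE (q : L) : (q : {poly F}) = ((q : {poly F})`_0)%:P + (q : {poly F})`_1 *: 'X.
  apply/polyP=> -[|[|i]]; rewrite coefD coefC coefZ coefX ?mulr0 ?addr0 ?mulr1 ?add0r //.
  apply: nth_default; rewrite -ltnS (leq_trans (size_mk_monic q)) //.
  by rewrite hE hs.
pose f (q : L) := line_mx t (q : {poly F})`_0 (q : {poly F})`_1.
have fE (q : L) : f q = horner_mx r (q : {poly F}).
  rewrite [in RHS]qE rmorphD /= horner_mxZ horner_mx_X horner_mx_C.
  by rewrite -line_mxE.
have f_inj : injective f.
  by move=> q q' /line_mx_inj[e0 e1]; apply: val_inj; rewrite /= qE e0 e1 -qE.
have fB : {morph f : x y / x - y}.
  by move=> x y; rewrite /f line_mxB -!coefB.
have fM : {morph f : x y / x * y}.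
  move=> x y; rewrite !fE poly_of_qpolyM.
  have hr : horner_mx r (mk_monic h) = 0 by rewrite hE.
  (* The product in the quotient is a remainder modulo [h], and [h] vanishes at [r]. *)
  have := Pdiv.RingMonic.rdivp_eq (monic_mk_monic h) ((x : {poly F}) * y).
  move/(congr1 (horner_mx r)); rewrite rmorphM rmorphD rmorphM /= hr mulr0 add0r.
  by [].
have fX (x : L) k : f (x ^+ k.+1) = f x ^+ k.+1.
  by elim: k => // k IHk; rewrite exprS fM IHk -exprS.
(* Constants are fixed by the power p^n = |F|, and the fixed set has no more elements than there are
   constants. *)
have constE : frobfix L p n = [set q : L | (q : {poly F})`_1 == 0].
  apply/esym/eqP; rewrite eqEcard; apply/andP; split.
    apply/subsetP=> q; rewrite !inE => /eqP q1; apply/eqP/f_inj.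
    have q_gt0 : (0 < p ^ n)%N by rewrite expn_gt0 prime_gt0.
    rewrite -(prednK q_gt0) fX prednK // /f q1 line_mx_scalar -rmorphXn /=.
    by rewrite -cardF expf_card.
  rewrite (card_frobfix n2_gt0 p_pr cardL) ?dvdn_mull // -cardF.
  have qC_inj : injective (qpolyC h : F -> L).
    by move=> a b /(congr1 (fun q : L => (q : {poly F})`_0)); rewrite /= !coefC.
  rewrite -(card_imset predT qC_inj); apply/subset_leq_card/subsetP => _ /imsetP[a _ ->].
  by rewrite inE /= coefC.
have -> : line_fsubs t = (fun S : {set L} => f @: S) @:
    [set fsub x | x in ~: frobfix L p n].
  rewrite line_fsubsE -imset_comp; apply/setP=> S.
  apply/imsetP/imsetP => [[[a b]]|[x]].
    rewrite inE /= => b0 ->; pose q := a%:P + b *: 'X : {poly F}.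
    have qh : (in_qpoly h q : {poly F}) = q.
      apply: in_qpoly_small; rewrite hE hs ltnS (leq_trans (size_polyD _ _)) // geq_max.
      rewrite (leq_trans (size_polyC_leq1 _)) //.
      by rewrite (leq_trans (size_scale_leq _ _)) ?size_polyX.
    have q0 : q`_0 = a by rewrite coefD coefC coefZ coefX mulr0 addr0.
    have q1 : q`_1 = b by rewrite coefD coefC coefZ coefX mulr1 add0r.
    exists (in_qpoly h q : L); first by rewrite constE !inE qh q1.
    by rewrite /= -(fsub_morph _ fB fM) /f qh q0 q1.
  rewrite constE !inE => x1 ->; exists ((x : {poly F})`_0, (x : {poly F})`_1).
    by rewrite inE.
  by rewrite /= -(fsub_morph _ fB fM).
rewrite card_imset; last exact: imset_inj.
by rewrite (card_fsub_notin n2_gt0 p_pr cardL) // count_divisors_double.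
Qed.
End Lines.

(** * The number of blocks of each kind *)

Section LineCount.
Variable F : finFieldType.
Implicit Types (x y u v : F).
Local Notation q := #|F|.
Local Notation roots xy := (line_roots (inl (inl xy) : line F)).

Lemma card_lines (P : pred (line F)) : #|[set t | P t]| =
  (#|[set xy | P (inl (inl xy))]| + #|[set y | P (inl (inr y))]| + P (inr tt))%N.
Proof.
rewrite -!sum1dep_card.
transitivity (\sum_(t : F * F + F + unit | P t) 1)%N; first by [].
rewrite !big_sumType /=; congr (_ + _)%N.
by rewrite big_mkcond /= (big_pred1 tt) //; case: (P _).
Qed.

Lemma mem_roots x y u : (u \in roots (x, y)) = (y == u * u - x * u).
Proof. by rewrite inE /line_tr /line_nm /= mulr1 eq_sym eq_sym addrC -subr_eq eq_sym. Qed.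

(** Double counting: for given x and root u, exactly one y makes u a root of u^2 = x u + y. *)
Lemma sum_card_roots : (\sum_(xy : F * F) #|roots xy| = q * q)%N.
Proof.
transitivity (\sum_(xy : F * F) \sum_(u in roots xy) 1)%N.
  by apply: eq_bigr => xy _; rewrite sum1_card.
rewrite pair_big_dep /= sum1dep_card -card_prod.
pose g (xu : F * F) := ((xu.1, xu.2 * xu.2 - xu.1 * xu.2), xu.2).
rewrite -(@card_imset _ _ g predT); last by move=> [x u] [x' u'] [-> _ ->].
apply: eq_card => -[[x y] u]; rewrite inE mem_roots /=; apply/eqP/imsetP.
  by move=> ->; exists (x, u).
by case=> -[x' u'] _ [-> -> ->].
Qed.

(** A quadratic with the single root u has coefficients (2u, -u^2). The map from u to these is
    injective even in characteristic 2, since u is recovered as the root. *)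
Lemma card_roots1 : #|[set xy : F * F | #|roots xy| == 1%N]| = q.
Proof.
pose g u := (u + u, - (u * u)).
have gE u : roots (g u) = [set u].
  have /line_rootsE-> : u \in roots (g u) by rewrite mem_roots; apply/eqP; ring.
  by rewrite /line_tr /= addrK setUid.
rewrite -(@card_imset _ _ g predT); last first.
  by move=> u v uv; apply/set1P; rewrite -gE -uv gE set11.
apply: eq_card => -[x y]; rewrite inE; apply/idP/imsetP => [|[u _ ->]]; last first.
  by rewrite gE cards1.
case/cards1P=> u uE; have ur : u \in roots (x, y) by rewrite uE set11.
have xu : x - u = u.
  by apply/set1P; rewrite -uE (line_rootsE ur) /line_tr /= !inE eqxx orbT.
have xE : x = u + u by rewrite -{1}xu subrK.
by exists u => //; move: ur; rewrite mem_roots => /eqP ->; rewrite /g xE; congr (_, _); ring.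
Qed.

(** As there are at most two roots, counting incidences gives N 1 + 2 N 2 = q^2, and counting
    quadratics gives N 0 + N 1 + N 2 = q^2; N 1 = q is known. *)
Lemma card_roots : let N (i : nat) := #|[set xy : F * F | #|roots xy| == i]| in
  (2 * N 2 + q = q * q /\ N 0 + q + N 2 = q * q)%N.
Proof.
move=> N; have N1 : N 1%N = q := card_roots1.
have NE i : N i = (\sum_(xy : F * F) (#|roots xy| == i))%N.
  by rewrite /N -sum1dep_card big_mkcond; apply: eq_bigr => xy _; case: eqP.
split.
  rewrite -sum_card_roots -[X in (_ + X = _)%N]N1 !NE big_distrr -big_split /=.
  apply: eq_bigr => xy _; have := card_line_roots_le (inl (inl xy)).
  by case: #|_| => [|[|[|]]].
rewrite -[X in (_ + X + _ = _)%N]N1 -card_prod -[RHS]sum1_card !NE -!big_split /=.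
apply: eq_bigr => xy _; have := card_line_roots_le (inl (inl xy)).
by case: #|_| => [|[|[|]]].
Qed.

Lemma card_lines_kind :
  let M (i : nat) := #|[set t : line F | #|line_roots t| == i]| in
  [/\ (2 * M 2 = q * q + q)%N, M 1%N = q.+1 & (2 * M 0 + q = q * q)%N].
Proof.
move=> M; have [e1 e2] := card_roots; have N1 := card_roots1.
(* On the remaining lines z = 0: those with x = 1 have the eigenvalues 0 and 1, and the last one is
   spanned by a nilpotent matrix. *)
have r1 y : #|line_roots (inl (inr y) : line F)| = 2%N.
  have z : 0 \in line_roots (inl (inr y) : line F).
    by rewrite inE /line_tr /line_nm /= !mulr0 addr0.
  by rewrite (line_rootsE z) cards2 /line_tr /= subr0 eq_sym oner_eq0.
have r0 : #|line_roots (inr tt : line F)| = 1%N.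
  have z : 0 \in line_roots (inr tt : line F).
    by rewrite inE /line_tr /line_nm /= !mulr0 addr0.
  by rewrite (line_rootsE z) cards2 /line_tr /= subr0 eqxx.
have ME j : M j = (#|[set xy : F * F | #|roots xy| == j]| + (2 == j) * q + (1 == j))%N.
  rewrite /M card_lines r0; congr (_ + _ + _)%N.
  case: (eqVneq 2%N j) => [<-|j2].
    by rewrite mul1n -[RHS]cardsT; apply: eq_card => y; rewrite !inE r1.
  by rewrite mul0n; apply: eq_card0 => y; rewrite !inE r1 (negPf j2).
rewrite !ME N1 /= in e1 e2 *. split; lia.
Qed.

End LineCount.

(** * The isomorphism *)

Section Assembly.
Variables (F : finFieldType) (p n : nat).
Hypotheses (n_gt0 : (0 < n)%N) (p_pr : prime p) (cardF : #|F| = (p ^ n)%N).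
Local Notation M := 'M[F]_2.
Local Notation t2 := ((p ^ (2 * n) + p ^ n) %/ 2)%N.
Local Notation t1 := (p ^ n + 1)%N.
Local Notation t0 := ((p ^ (2 * n) - p ^ n) %/ 2)%N.

Definition line_kind (t : line F) : option bool :=
  if #|line_roots t| == 2%N then Some true
  else if #|line_roots t| == 1%N then Some false else None.

Definition block_kind (i : 'I_t2 + 'I_t1 + 'I_t0) : option bool :=
  match i with
  | inl (inl _) => Some true
  | inl (inr _) => Some false
  | inr _ => None
  end.

Lemma line_block_bij : exists2 s : line F -> 'I_t2 + 'I_t1 + 'I_t0,
  bijective s & forall t, block_kind (s t) = line_kind t.
Proof.
apply: (@partition_bij _ _ _ _ line_kind block_kind id).
  by exists id.
have [c2 c1 c0] := card_lines_kind F; rewrite cardF in c2 c1 c0.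
have qq : (p ^ (2 * n) = p ^ n * p ^ n)%N by rewrite mul2n -addnn expnD.
have b2 : #|[set i | block_kind i == Some true]| = t2.
  rewrite -[RHS]card_ord -(card_imset predT (f := fun i : 'I_t2 => inl (inl i) : 'I_t2 + 'I_t1 + 'I_t0)).
    by apply: eq_card => -[[i|i]|i]; rewrite !inE; apply/eqP/imsetP => [|[]] // _; exists i.
  by move=> i j [].
have b1 : #|[set i | block_kind i == Some false]| = t1.
  rewrite -[RHS]card_ord -(card_imset predT (f := fun i : 'I_t1 => inl (inr i) : 'I_t2 + 'I_t1 + 'I_t0)).
    by apply: eq_card => -[[i|i]|i]; rewrite !inE; apply/eqP/imsetP => [|[]] // _; exists i.
  by move=> i j [].
have b0 : #|[set i | block_kind i == None]| = t0.
  rewrite -[RHS]card_ord -(card_imset predT (f := fun i : 'I_t0 => inr i : 'I_t2 + 'I_t1 + 'I_t0)).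
    by apply: eq_card => -[[i|i]|i]; rewrite !inE; apply/eqP/imsetP => [|[]] // _; exists i.
  by move=> i j [].
have kE (k : option bool) (j : nat) : (forall t, (line_kind t == k) = (#|line_roots t| == j)) ->
    #|[set t | line_kind t == k]| = #|[set t : line F | #|line_roots t| == j]|.
  by move=> E; apply: eq_card => t; rewrite !inE E.
have kind_eq (t : line F) := card_line_roots_le t.
move=> [[]|].
- rewrite b2 (kE _ 2%N) => [|t]; first by rewrite qq -c2 mulKn.
  by rewrite /line_kind; case: (#|_|) (kind_eq t) => [|[|[|]]].
- rewrite b1 (kE _ 1%N) => [|t]; first by rewrite c1 addn1.
  by rewrite /line_kind; case: (#|_|) (kind_eq t) => [|[|[|]]].
- rewrite b0 (kE _ 0%N) => [|t]; first by rewrite qq -c0 addnK mulKn.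
  by rewrite /line_kind; case: (#|_|) (kind_eq t) => [|[|[|]]].
Qed.

Definition subrings : {set {set M}} := [set fsub A | A : M].

Lemma fsub_commutes (A B C : M) : fsub A = fsub B -> A * C = C * A -> B * C = C * B.
Proof.
move=> /fsub_eqP e AC.
have [q _ <-] : gen_subring A B by rewrite e; apply: gen_subring_id.
by apply/esym/horner_intr_comm/esym.
Qed.

(** Generators of the same subring have the same centralizer, and the centralizer determines the
    line. This makes the block of a vertex independent of its generator. *)
Lemma line_of_fsub (A B : M) : fsub A = fsub B -> line_of A = line_of B.
Proof.
move=> e; have comm C : A * C = C * A <-> B * C = C * B.
  by split; apply: fsub_commutes; rewrite e.
have key C D : (forall E : M, C * E = E * C -> D * E = E * D) -> line_of C = None ->
    line_of D = None.
  move=> CD C0; case E : (line_of D) => [t|//].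
  (* A matrix on the line [t] that commuted with every matrix would make all lines equal to [t]. *)
  have mem t' : t' = t.
    have := CD (line_mx t' 0 1); rewrite !line_of_comm C0 E line_of_mx ?oner_neq0 //.
    by case=> [|//|//|[]]; first by constructor 1.
  by have := mem (inl (inr 0)); rewrite -(mem (inr tt)).
case EA : (line_of A) => [t|]; last by apply/esym/(key A) => // E /comm.
case EB : (line_of B) => [t'|]; last by rewrite -EA; apply: (key B) => // E /comm.
have /comm : A * A = A * A by [].
by rewrite line_of_comm EA EB; case=> // ->.
Qed.

Definition subring_type : finType := {S : {set M} | S \in subrings}.

Lemma subring_typeP (S : subring_type) : exists A, fsub A == val S.
Proof. by have /imsetP[A _ ->] := valP S; exists A. Qed.

Definition subring_gen (S : subring_type) : M := xchoose (subring_typeP S).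

Lemma subring_genE S : fsub (subring_gen S) = val S.
Proof. exact/eqP/(xchooseP (subring_typeP S)). Qed.

Definition subring_line (S : subring_type) : option (line F) :=
  line_of (subring_gen S).

Lemma card_subring_line (l : option (line F)) :
  #|[set S | subring_line S == l]| = #|[set fsub A | A in [set A : M | line_of A == l]]|.
Proof.
rewrite -(card_imset _ val_inj); apply: eq_card => S; apply/imsetP/imsetP.
  by case=> T; rewrite inE => Tl ->; exists (subring_gen T); rewrite ?subring_genE ?inE.
case=> A; rewrite inE => Al SE; have Ssub : S \in subrings by rewrite SE imset_f.
exists (Sub S Ssub : subring_type) => //; rewrite inE -(eqP Al); apply/eqP/line_of_fsub.
by rewrite subring_genE -SE.
Qed.

Local Notation target := ('I_(num_divisors n + 1) +
  ('I_t2 * 'I_(a' p n) + 'I_t1 * 'I_(b' p n) + 'I_t0 * 'I_(c n)))%type.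

(** [None] marks the clique joined to everything, just as [line_of] is [None] on scalars. *)
Definition target_block (x : target) : option ('I_t2 + 'I_t1 + 'I_t0) :=
  match x with
  | inl _ => None
  | inr (inl (inl (i, _))) => Some (inl (inl i))
  | inr (inl (inr (i, _))) => Some (inl (inr i))
  | inr (inr (i, _)) => Some (inr i)
  end.

Lemma card_target_block l : #|[set x | target_block x == l]| =
  match l with
  | None => (num_divisors n + 1)%N
  | Some (inl (inl _)) => a' p n
  | Some (inl (inr _)) => b' p n
  | Some (inr _) => c n
  end.
Proof.
case: l => [[[i|i]|i]|]; rewrite -[RHS]card_ord.
- rewrite -(card_imset predT (f := fun j : 'I_(a' p n) => inr (inl (inl (i, j))) : target)).
    apply: eq_card => -[j|[[[k j]|[k j]]|[k j]]]; rewrite !inE /=;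
      by apply/eqP/imsetP => [//|[]] // => [[->]|_ _ [->]] //; exists j.
  by move=> j j' [].
- rewrite -(card_imset predT (f := fun j : 'I_(b' p n) => inr (inl (inr (i, j))) : target)).
    apply: eq_card => -[j|[[[k j]|[k j]]|[k j]]]; rewrite !inE /=;
      by apply/eqP/imsetP => [//|[]] // => [[->]|_ _ [->]] //; exists j.
  by move=> j j' [].
- rewrite -(card_imset predT (f := fun j : 'I_(c n) => inr (inr (i, j)) : target)).
    apply: eq_card => -[j|[[[k j]|[k j]]|[k j]]]; rewrite !inE /=;
      by apply/eqP/imsetP => [//|[]] // => [[->]|_ _ [->]] //; exists j.
  by move=> j j' [].
rewrite -(card_imset predT (f := fun j : 'I_(num_divisors n + 1) => inl j : target)).
  apply: eq_card => -[j|[[[k j]|[k j]]|[k j]]]; rewrite !inE /=;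
    by apply/eqP/imsetP => [//|[]] //; exists j.
by move=> j j' [].
Qed.

Lemma card_fsub_scalar :
  #|[set fsub A | A in [set A : M | line_of A == None]]| = (num_divisors n + 1)%N.
Proof.
rewrite -(card_fsub_field n_gt0 p_pr cardF).
pose f (a : F) : M := a%:M.
have f_inj : injective f.
  by move=> a b; rewrite /f -!(line_mx_scalar (inr tt)) => /line_mx_inj[].
have fB : {morph f : x y / x - y} by move=> x y; rewrite /f raddfB.
have fM : {morph f : x y / x * y} by move=> x y; rewrite /f -mulmxE scalar_mxM.
rewrite -[RHS](card_imset _ (imset_inj f_inj)) -imset_comp.
apply: eq_card => S; apply/imsetP/imsetP => [[A]|[a _ ->]].
  rewrite inE => A0 ->; have := line_ofP A; rewrite (eqP A0) => -[a ->].
  by exists a; rewrite //= -(fsub_morph _ fB fM).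
by exists (f a); rewrite ?inE ?line_of_scalar //= -(fsub_morph _ fB fM).
Qed.

(** The bijection from lines to block indices is extended by [None], and the fibre cardinalities
    over each line agree with the sizes of the cliques. Being in the same block or in the clique of
    scalars is then the same as commuting. *)
Lemma subring_target_bij : exists2 f : subring_type -> target, bijective f &
  forall S T, (target_block (f S) = None \/ target_block (f T) = None \/
               target_block (f S) = target_block (f T)) <->
    subring_gen S * subring_gen T = subring_gen T * subring_gen S.
Proof.
have [s s_bij sE] := line_block_bij; have s_inj := bij_inj s_bij.
have os_bij : bijective (omap s).
  by case: s_bij => s' sK s'K; exists (omap s') => -[t|] //=; rewrite ?sK ?s'K.
have [|f f_bij fE] := @partition_bij _ _ _ _ subring_line target_block (omap s) os_bij.
  move=> l; rewrite card_subring_line card_target_block.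
  case: l => [t|]; last exact: card_fsub_scalar.
  rewrite -/(line_fsubs t) /=; have := sE t; rewrite /line_kind.
  case: (s t) => [[i|i]|i] /=.
  - by case: eqP => [r2 _|_]; [exact: card_line_fsubs2 n_gt0 p_pr cardF _ r2 | case: ifP].
  - by case: eqP => // _; case: eqP => // r1 _; exact: card_line_fsubs1 n_gt0 p_pr cardF _ r1.
  - case: eqP => // n2; case: eqP => // n1 _; apply: card_line_fsubs0 n_gt0 p_pr cardF _ _.
    by move: (card_line_roots_le t) n2 n1; case: #|_| => [|[|[|]]].
exists f => // S T; rewrite !fE line_of_comm -/(subring_line S) -/(subring_line T).
case: (subring_line S) (subring_line T) => [t|] [t'|] /=; split;
  try (by constructor 1); try (by constructor 2); try (by right; left); try by left.
- by case=> // -[] // [/s_inj->]; constructor 3.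
- by case=> // -[->]; right; right.
Qed.

End Assembly.

Local Close Scope ring_scope.

Theorem theorem22 (n p : nat) (F : finFieldType)
  (hn : 1 <= n) (hp : prime p) (hF : #|F| = p ^ n) :
  graph_iso (compressed_commuting_graph 'M[F]_2)
    (gjoin (looped_complete (num_divisors n + 1))
       (gunion
          (gunion
             (gcopies ((p ^ (2 * n) + p ^ n) %/ 2) (looped_complete (a' p n)))
             (gcopies (p ^ n + 1) (looped_complete (b' p n))))
          (gcopies ((p ^ (2 * n) - p ^ n) %/ 2) (looped_complete (c n))))).
Proof.
have [f f_bij fE] := subring_target_bij hn hp hF.
pose V := ccg_vertex 'M[F]_2.
have toP (v : V) : [set A | `[< val v A >]] \in subrings F.
  have /classical_sets.set_mem[A _ AE] := valP v; apply/imsetP; exists A => //.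
  by apply/setP=> B; rewrite !inE -AE.
(* Vertices are matched with finite sets of matrices. The chosen generator of the finite set also
   generates the vertex, so adjacency becomes commutation of chosen generators. *)
pose to (v : V) : subring_type F := exist (fun S => S \in subrings F) _ (toP v).
pose of_ (S : subring_type F) : V := exist _ (gen_subring (subring_gen S))
  (classical_sets.mem_set (ex_intro2 _ _ (subring_gen S) I erefl)).
have toK : cancel to of_.
  move=> v; apply: val_inj => /=; have /classical_sets.set_mem[A _ AE] := valP v.
  rewrite -AE; apply/fsub_eqP; rewrite subring_genE /=.
  by apply/setP=> B; rewrite !inE -AE.
have ofK : cancel of_ to.
  move=> S; apply: val_inj => /=; rewrite -[RHS]subring_genE.
  by apply/setP=> B; rewrite !inE.
exists (f \o to); split; first by apply: bij_comp f_bij _; exists of_.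
move=> u v; rewrite /= -{1}(toK u) -{1}(toK v).
rewrite (@ccg_adjE _ _ _ (subring_gen (to u)) (subring_gen (to v))) //.
rewrite -fE; move: (f (to u)) (f (to v)).
move=> [i|[[[i x]|[i x]]|[i x]]] [j|[[[j y]|[j y]]|[j y]]] /=;
  rewrite /gjoin_adj /= /gcopies_adj /=; split=> //; try (by move=> _; tauto);
  try by case=> // -[] // [->].
all: by case=> -> _; right; right.
Qed.
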